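(* Assume that $A$ is a Lie algebroid and $\omega\in\Gamma(\wedge^2A^* )$ is a $2$-cochain of $A$ whose restriction $\omega|_B$ to a Lie subalgebroid $B$ of $A$ is fiberwise non-degenerate. If $\pi\in\Gamma(\wedge^2B)$ denotes the inverse of $\omega|_B$, then $(\pi,-d_A\omega)$ is a regular twisted Poisson structure on the Lie algebroid $A$.
   Context: $d_A$ is the Lie algebroid cohomology operator on $\Gamma(\wedge^\bullet A^* )$. A twisted Poisson structure on a Lie algebroid $A$ is a pair $(\pi,\psi)$ with $\pi\in\Gamma(\wedge^2A)$, $\psi\in\Gamma(\wedge^3A^* )$, $d_A\psi=0$, and $\frac12[\pi,\pi]_A=(\wedge^3\pi^\sharp)\psi$. Here $[\,,]_A$ is the Schouten bracket of multisections of $A$, extending the Lie algebroid bracket, and $\pi^\sharp\colon A^*\to A$ is the map $\alpha\mapsto i_\alpha\pi$. The structure is regular if $\pi^\sharp$ has constant rank. Inverses: a non-degenerate bivector $\pi\in\Gamma(\wedge^2B)\subset\Gamma(\wedge^2A)$, with associated isomorphism $\pi^\sharp_{(B)}\colon B^*\to B$ defined by $\pi^\sharp$, and a fiberwise non-degenerate $\omega_B\in\Gamma(\wedge^2B^* )$ are inverses of one another if $i_X\omega_B=-(\pi^\sharp_{(B)})^{-1}(X)$ for all $X\in\Gamma(B)$; with these conventions $\omega_B(\pi^\sharp\alpha,\pi^\sharp\beta)=\pi(\alpha,\beta)$ for all $\alpha,\beta\in\Gamma(A^* )$. *)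

(* Defs.v *)
From HB Require Import structures.
From mathcomp Require Import all_boot all_order all_algebra.
From mathcomp Require Import all_classical all_reals all_analysis.

Set Implicit Arguments.
Unset Strict Implicit.
Unset Printing Implicit Defensive.

Import Order.TTheory GRing.Theory Num.Theory.
Import numFieldNormedType.Exports.

Local Open Scope classical_set_scope.
Local Open Scope ring_scope.

Definition pair2 (T : Type) (a b : T) : 'I_2 -> T := tnth [tuple a; b].
Definition triple3 (T : Type) (a b c : T) : 'I_3 -> T := tnth [tuple a; b; c].

(** * Multilinear algebra *)

Section Multilinear.
Variable R : realType.
Implicit Type V : vectType R.

Definition dual V := 'Hom(V, R^o).

Definition upd (T : Type) k (v : 'I_k -> T) (i : 'I_k) (w : T) : 'I_k -> T :=
  fun j => if j == i then w else v j.

Definition is_alternating V k (f : ('I_k -> V) -> R) : Prop :=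
  (forall v i a u w,
     f (upd v i (a *: u + w)) = a * f (upd v i u) + f (upd v i w)) /\
  (forall v i j, i != j -> v i = v j -> f v = 0).

(* Wedge^k V is realized as the space of alternating k-linear forms on the dual
   of V, with the determinant pairing
   (v_0 /\ ... /\ v_(k-1)) (a_0, ..., a_(k-1)) = det (a_i (v_j)). *)
Definition wedge V k (v : 'I_k -> V) : ('I_k -> dual V) -> R :=
  fun a => \det (\matrix_(i, j) (a i (v j) : R)).

(* sharp P a = i_a P: the vector of V whose pairing with b is P (a, b) for every
   covector b, written in a basis of V in order to go through V ** = V. *)
Definition sharp V (P : ('I_2 -> dual V) -> R) (a : dual V) : V :=
  \sum_i P (pair2 a (linfun (coord (vbasis {:V}) i))) *: (vbasis {:V})`_i.

Definition sharp_hom V (P : ('I_2 -> dual V) -> R) : 'Hom(dual V, V) :=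
  linfun (sharp P).

Definition nondegenerate_form V (w : ('I_2 -> V) -> R) : Prop :=
  forall v, (forall u, w (pair2 v u) = 0) -> v = 0.

(* i_v w = - (P^sharp)^-1 v for all v, the inverse being the one of
   P^sharp : V^* -> V, which is required to be an isomorphism. *)
Definition inverse_of V (P : ('I_2 -> dual V) -> R) (w : ('I_2 -> V) -> R) :
    Prop :=
  bijective (sharp_hom P) /\
  (forall v u, w (pair2 v u) = - ((sharp_hom P)^-1%VF v) u).

End Multilinear.

(** * Smooth manifolds *)

Fixpoint class_C (R : realType) n k (U : set 'rV[R]_n) (f : 'rV[R]_n -> R) :
    Prop :=
  (forall x, U x -> {for x, continuous f}) /\
  (if k is k'.+1 then
     forall i : 'I_n, (forall x, U x -> derivable f x (delta_mx 0 i)) /\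
                      class_C k' U (fun x => 'D_(delta_mx 0 i) f x)
   else True).

(* The atlas is indexed by the points, chart p being a chart around p; it is
   meaningful on chart_dom p only, and chart_inv p on the image of chart_dom p. *)
Record manifold (R : realType) := Manifold {
  points :> topologicalType;
  dimM : nat;
  chart_dom : points -> set points;
  chart : points -> points -> 'rV[R]_dimM;
  chart_inv : points -> 'rV[R]_dimM -> points;
  chart_dom_open : forall p, open (chart_dom p);
  chart_dom_mem : forall p, chart_dom p p;
  chartK : forall p x, chart_dom p x -> chart_inv p (chart p x) = x;
  chart_img_open : forall p, open (chart p @` chart_dom p);
  chart_continuous : forall p x, chart_dom p x -> {for x, continuous (chart p)};
  chart_inv_continuous : forall p y, (chart p @` chart_dom p) y ->
    {for y, continuous (chart_inv p)};
  chart_transition : forall p q (i : 'I_dimM) k,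
    class_C k (chart p @` (chart_dom p `&` chart_dom q))
      (fun y => chart q (chart_inv p y) 0 i);
  manifold_hausdorff : hausdorff_space points;
  manifold_second_countable : @second_countable points
}.

Section SmoothFunctions.
Variables (R : realType) (M : manifold R).

Definition smooth_on (U : set M) (f : M -> R) : Prop :=
  forall (p : M) k,
    class_C k (chart p @` (chart_dom p `&` U)) (f \o chart_inv p).

(* T_x M as the space of derivations of the algebra of germs at x of smooth
   functions; only the values of v at functions smooth near x are relevant. *)
Definition is_tangent (x : M) (v : (M -> R) -> R) : Prop :=
  forall (U : set M) (f g : M -> R), open U -> U x ->
    smooth_on U f -> smooth_on U g ->
  [/\ forall a : R, v (fun y => a * f y + g y) = a * v f + v g,
      v (fun y => f y * g y) = v f * g x + f x * v g
    & (forall y, U y -> f y = g y) -> v f = v g].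

End SmoothFunctions.

(** * Vector bundles *)

(* A bundle is given by its fibers and by local frames, frame p being a frame
   over the neighborhood frame_dom p of p, with smooth changes of frames. *)
Record vbundle (R : realType) (M : manifold R) := VBundle {
  fiber :> M -> vectType R;
  rk : nat;
  frame_dom : M -> set M;
  frame : M -> forall x : M, rk.-tuple (fiber x);
  frame_dom_open : forall p, open (frame_dom p);
  frame_dom_mem : forall p, frame_dom p p;
  frame_basis : forall p x, frame_dom p x -> basis_of fullv (frame p x);
  frame_transition : forall p q (i j : 'I_rk),
    smooth_on (frame_dom p `&` frame_dom q)
      (fun x => coord (frame q x) j (tnth (frame p x) i))
}.

Section Sections.
Variables (R : realType) (M : manifold R).
Implicit Types E F : vbundle M.

Definition section E := forall x : M, E x.

(* X in Gamma(U, E). *)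
Definition smooth_section E (U : set M) (X : section E) : Prop :=
  forall (p : M) (j : 'I_(rk E)),
    smooth_on (U `&` frame_dom E p) (fun x => coord (frame E p x) j (X x)).

Definition cosection E := forall x : M, dual (E x).

(* a in Gamma(U, E^* ). *)
Definition smooth_cosection E (U : set M) (a : cosection E) : Prop :=
  forall (V : set M) (X : section E), open V -> V `<=` U ->
    smooth_section V X -> smooth_on V (fun x => a x (X x)).

Definition kform E k := forall x : M, ('I_k -> E x) -> R.

(* w in Gamma(Wedge^k E^* ). *)
Definition is_kform E k (w : kform E k) : Prop :=
  (forall x, is_alternating (w x)) /\
  (forall (U : set M) (X : 'I_k -> section E), open U ->
     (forall i, smooth_section U (X i)) ->
     smooth_on U (fun x => w x (fun i => X i x))).

Definition kvector E k := forall x : M, ('I_k -> dual (E x)) -> R.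

(* P in Gamma(Wedge^k E). *)
Definition is_kvector E k (P : kvector E k) : Prop :=
  (forall x, is_alternating (P x)) /\
  (forall (U : set M) (a : 'I_k -> cosection E), open U ->
     (forall i, smooth_cosection U (a i)) ->
     smooth_on U (fun x => P x (fun i => a i x))).

Definition bundle_map E F := forall x : M, 'Hom(E x, F x).

Definition restrict_form E F (h : bundle_map E F) k (w : kform F k) :
    kform E k :=
  fun x v => w x (fun i => h x (v i)).

Definition push_kvector E F (h : bundle_map E F) k (P : kvector E k) :
    kvector F k :=
  fun x a => P x (fun i => (a i \o h x)%VF).

(* (Wedge^k P^sharp) w, as the k-vector (a_1, ..., a_k) |->
   w (P^sharp a_1, ..., P^sharp a_k).  Transporting w by Wedge^k of the linear
   map P^sharp, for the determinant pairing, would give (-1)^k times this,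
   P^sharp being skew; this convention is the one for which
   (Wedge^2 P^sharp) w = P and (Wedge^3 P^sharp) (- d w) = [P, P] / 2 when
   i_X w = - (P^sharp)^-1 X. *)
Definition wedge_sharp E k (P : kvector E 2) (w : kform E k) : kvector E k :=
  fun x a => w x (fun i => sharp (P x) (a i)).

Definition regular E (P : kvector E 2) : Prop :=
  exists r : nat, forall x, \dim (limg (sharp_hom (P x))) = r.

End Sections.

Arguments restrict_form {R M E F} h {k} w x v.
Arguments push_kvector {R M E F} h {k} P x a.
Arguments wedge_sharp {R M E k} P w x a.

(** * Lie algebroids *)

(* The bracket of a Lie algebroid is local, and thus is defined on the sections
   over every open set, compatibly with restrictions.  Here bracket X Y x only
   has a meaning when X and Y are smooth near x, and then it only depends on
   the germs of X and Y; the Lie algebra structure of Gamma(A) is the case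
   U = setT of the axioms. *)
Record lie_algebroid (R : realType) (M : manifold R) := LieAlgebroid {
  la_bundle :> vbundle M;
  anchor : forall x : M, la_bundle x -> (M -> R) -> R;
  bracket : section la_bundle -> section la_bundle -> section la_bundle;
  anchor_tangent : forall x u, is_tangent x (@anchor x u);
  anchor_linear : forall x a u v (U : set M) f, open U -> U x ->
    smooth_on U f -> @anchor x (a *: u + v) f = a * @anchor x u f + @anchor x v f;
  anchor_smooth : forall (U : set M) X f, open U ->
    smooth_section U X -> smooth_on U f ->
    smooth_on U (fun x => @anchor x (X x) f);
  bracket_smooth : forall (U : set M) X Y, open U ->
    smooth_section U X -> smooth_section U Y -> smooth_section U (bracket X Y);
  bracket_local : forall (U : set M) X X' Y Y', open U ->
    smooth_section U X -> smooth_section U Y ->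
    (forall x, U x -> X x = X' x) -> (forall x, U x -> Y x = Y' x) ->
    forall x, U x -> bracket X Y x = bracket X' Y' x;
  bracket_linear : forall (U : set M) (a : R) X Y Z, open U ->
    smooth_section U X -> smooth_section U Y -> smooth_section U Z ->
    forall x, U x ->
    bracket (fun y => a *: X y + Y y) Z x = a *: bracket X Z x + bracket Y Z x;
  bracket_skew : forall (U : set M) X Y, open U ->
    smooth_section U X -> smooth_section U Y ->
    forall x, U x -> bracket X Y x = - bracket Y X x;
  bracket_jacobi : forall (U : set M) X Y Z, open U ->
    smooth_section U X -> smooth_section U Y -> smooth_section U Z ->
    forall x, U x ->
    bracket X (bracket Y Z) x + bracket Y (bracket Z X) x
      + bracket Z (bracket X Y) x = 0;
  bracket_leibniz : forall (U : set M) X Y f, open U ->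
    smooth_section U X -> smooth_section U Y -> smooth_on U f ->
    forall x, U x ->
    bracket X (fun y => f y *: Y y) x
      = f x *: bracket X Y x + @anchor x (X x) f *: Y x;
  anchor_bracket : forall (U : set M) X Y f, open U ->
    smooth_section U X -> smooth_section U Y -> smooth_on U f ->
    forall x, U x ->
    @anchor x (bracket X Y x) f
      = @anchor x (X x) (fun y => @anchor y (Y y) f)
        - @anchor x (Y x) (fun y => @anchor y (X y) f)
}.

Arguments anchor {R M} A x u f : rename.
Arguments bracket {R M} A X Y : rename.

Section LieAlgebroid.
Variables (R : realType) (M : manifold R) (A : lie_algebroid M).

(* The section with constant coordinates extending u in the frame around x. *)
Definition extend (x : M) (u : A x) : section A :=
  fun y => \sum_(l < rk A) coord (frame A x x) l u *: tnth (frame A x y) l.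

(* The value at x of
     sum_i (-1)^i rho(X_i) w(.., X_i omitted, ..)
     + sum_(i < j) (-1)^(i+j) w([X_i, X_j], .., X_i and X_j omitted, ..). *)
Definition koszul k (w : kform A k) (X : 'I_k.+1 -> section A) (x : M) : R :=
  \sum_(i < k.+1) (-1) ^+ i
     * anchor A x (X i x) (fun y => w y (fun l => X (lift i l) y))
  + \sum_(i < k.+1) \sum_(j < k.+1 | (i < j)%N) (-1) ^+ (i + j)
     * w x (fun l => nth 0 (bracket A (X i) (X j) x
              :: [seq X m x | m <- enum 'I_k.+1 & (m != i) && (m != j)]) l).

(* d_A; the value at x does not depend on the smooth extensions of the v_i. *)
Definition dA k (w : kform A k) : kform A k.+1 :=
  fun x v => koszul w (fun i => extend (v i)) x.

(* [X1 /\ X2, Y1 /\ Y2] = sum_(i, j) (-1)^(i+j) [X_i, Y_j] /\ X_i' /\ Y_j'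
   where {i, i'} = {j, j'} = {1, 2}. *)
Definition schouten_decomposable (X Y : section A * section A) : kvector A 3 :=
  fun x a =>
    wedge (triple3 (bracket A X.1 Y.1 x) (X.2 x) (Y.2 x)) a
    - wedge (triple3 (bracket A X.1 Y.2 x) (X.2 x) (Y.1 x)) a
    - wedge (triple3 (bracket A X.2 Y.1 x) (X.1 x) (Y.2 x)) a
    + wedge (triple3 (bracket A X.2 Y.2 x) (X.1 x) (Y.1 x)) a.

(* Near p, P = sum_(i, j) (P^ij / 2) e_i /\ e_j in the frame around p. *)
Definition decompose (P : kvector A 2) (p : M) : seq (section A * section A) :=
  [seq ((fun y : M =>
           (2^-1 * P y (pair2 (linfun (coord (frame A p y) i))
                              (linfun (coord (frame A p y) j))))
           *: tnth (frame A p y) i),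
        (fun y : M => tnth (frame A p y) j))
     | i <- enum 'I_(rk A), j <- enum 'I_(rk A)].

(* The Schouten bracket of bivectors: the R-bilinear extension of the formula on
   decomposable bivectors; the value at x does not depend on the decompositions
   near x. *)
Definition schouten (P Q : kvector A 2) : kvector A 3 :=
  fun x a => \sum_(X <- decompose P x) \sum_(Y <- decompose Q x)
               schouten_decomposable X Y a.

Definition twisted_poisson (P : kvector A 2) (psi : kform A 3) : Prop :=
  [/\ is_kvector P,
      is_kform psi,
      forall x (v : 'I_4 -> A x), dA psi v = 0
    & forall x (a : 'I_3 -> dual (A x)),
        2^-1 * schouten P P a = wedge_sharp P psi x a].

End LieAlgebroid.

Arguments dA {R M A k} w x v.
Arguments schouten {R M A} P Q x a.

(* A Lie subalgebroid of A, as a Lie algebroid B over the same base with an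
   injective morphism h to A, i.e. the subbundle of A is the image of h. *)
Definition lie_subalgebroid (R : realType) (M : manifold R)
    (A B : lie_algebroid M) (h : bundle_map B A) : Prop :=
  [/\ forall x, injective (h x),
      forall (U : set M) (X : section B), open U -> smooth_section U X ->
        smooth_section U (fun x => h x (X x) : A x),
      forall x u (U : set M) f, open U -> U x -> smooth_on U f ->
        anchor A x (h x u) f = anchor B x u f
    & forall (U : set M) (X Y : section B), open U ->
        smooth_section U X -> smooth_section U Y ->
        forall x, U x ->
        bracket A (fun y => h y (X y)) (fun y => h y (Y y)) x
          = h x (bracket B X Y x)].

(* Main.v *)
Require Import Defs.
From HB Require Import structures.
From mathcomp Require Import all_boot all_order all_algebra.
From mathcomp Require Import all_classical all_reals all_analysis.
From mathcomp Require Import ring lra.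

Set Implicit Arguments.
Unset Strict Implicit.
Unset Printing Implicit Defensive.

Import Order.TTheory GRing.Theory Num.Theory.
Import numFieldNormedType.Exports.

Local Open Scope classical_set_scope.
Local Open Scope ring_scope.

(* Write Q for the bivector P seen on A. For every bivector Q,
     1/2 [Q, Q] (a, b, c)
       = cyclic sum of c ([Q^sharp a, Q^sharp b]) - rho (Q^sharp a) (Q (b, c)),
   an identity between expressions that are bilinear in Q; after polarization it
   is checked on decomposable bivectors, where only the Leibniz rule intervenes.
   On the other hand omega (Q^sharp b, Q^sharp c) = Q (b, c), and
   omega (X, Q^sharp c) = c (X) for X in B; as B is involutive this applies to
   X = [Q^sharp a, Q^sharp b], so that the Koszul formula for
   - d omega (Q^sharp a, Q^sharp b, Q^sharp c) is the same cyclic sum.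
   The form d omega is closed because d_A squares to zero, which follows from the
   Jacobi identity once the Koszul formula is known to be tensorial, and the rank
   of Q^sharp is that of B. *)

(** * Smooth functions *)

Section ClassC.
Variables (R : realType) (n : nat).
Implicit Types (U V : set 'rV[R]_n) (f g : 'rV[R]_n -> R).

Lemma class_C_sub k U V f : V `<=` U -> class_C k U f -> class_C k V f.
Proof.
elim: k f => [|k IH] f VU [fc fd].
  by split=> // x /VU; exact: fc.
split=> [x /VU|i]; first exact: fc.
have [fi fk] := fd i; split; last exact: IH.
by move=> x /VU /fi.
Qed.

(** Openness of [U] turns equality on [U] into equality near each of its points, which is all that
    limits and derivatives see; the partial derivatives then agree on [U] as well, and the induction
    goes on. *)
Lemma class_C_ext k U f g : open U -> (forall x, U x -> f x = g x) ->
  class_C k U f -> class_C k U g.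
Proof.
move=> oU; elim: k f g => [|k IH] f g fg fC; have [fc fd] := fC.
all: have fgn x : U x -> {near x, f =1 g} by
  (move=> Ux; apply: (filterS _ (open_nbhs_nbhs (conj oU Ux))) => y; exact: fg).
all: have gc x : U x -> {for x, continuous g} by
  (move=> Ux; rewrite /prop_for /continuous_at -(fg x Ux);
   exact: (cvg_trans (near_eq_cvg (fgn x Ux)) (fc x Ux))).
  by split.
split=> // i; have [fi fk] := fd i; split.
  by move=> x Ux; apply: near_eq_derivable (fi x Ux); exact: fgn.
by apply: IH fk => x Ux; apply: near_eq_derive; exact: fgn.
Qed.

Lemma class_C_pred k U f : class_C k.+1 U f -> class_C k U f.
Proof.
elim: k f => [|k IH] f [fc fd]; split => // i.
by have [fi fk] := fd i; split=> //; apply: IH.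
Qed.

Lemma class_C_cst k U (c : R) : class_C k U (fun=> c).
Proof.
elim: k c => [|k IH] c.
  by split=> // x _; exact: cst_continuous.
split=> [x _|i]; first exact: cst_continuous.
split=> [x _|]; first exact: derivable_cst.
by under eq_fun do rewrite derive_cst.
Qed.

Lemma class_CD k U f g : open U -> class_C k U f -> class_C k U g ->
  class_C k U (fun x => f x + g x).
Proof.
move=> oU; elim: k f g => [|k IH] f g [fc fd] [gc gd].
  by split=> // x Ux; apply: continuousD; [exact: fc|exact: gc].
split=> [x Ux|i]; first by apply: continuousD; [exact: fc|exact: gc].
have [fi fk] := fd i; have [gi gk] := gd i; split=> [x Ux|].
  by apply: derivableD; [exact: fi|exact: gi].
apply: class_C_ext (IH _ _ fk gk) => // x Ux.
by rewrite -deriveD //; [exact: fi|exact: gi].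
Qed.

Lemma class_CM k U f g : open U -> class_C k U f -> class_C k U g ->
  class_C k U (fun x => f x * g x).
Proof.
move=> oU; elim: k f g => [|k IH] f g fC gC.
  have [fc _] := fC; have [gc _] := gC.
  by split=> // x Ux; apply: continuousM; [exact: fc|exact: gc].
have [fc fd] := fC; have [gc gd] := gC.
split=> [x Ux|i]; first by apply: continuousM; [exact: fc|exact: gc].
have [fi fk] := fd i; have [gi gk] := gd i; split=> [x Ux|].
  by apply: derivableM; [exact: fi|exact: gi].
(* The product rule mixes [f] and [g] with their derivatives, so [class_C_pred] lowers [f] and [g]
   to class [k] before the induction hypothesis is applied. *)
have := class_CD oU (IH _ _ (class_C_pred fC) gk) (IH _ _ (class_C_pred gC) fk).
apply: class_C_ext => // x Ux.
by rewrite -[RHS]/('D_(delta_mx 0 i) (f * g) x) deriveM //; [exact: fi|exact: gi].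
Qed.

End ClassC.

(** * Smooth functions on the open sets of a manifold *)

Section SmoothFunctionAlgebra.
Variables (R : realType) (M : manifold R).
Implicit Types (U V : set M) (f g : M -> R).

(** In the chart, this image is the part of the chart's range that the continuous map [chart_inv p]
    sends into [U]. It makes the results on [class_C] over open sets available for [smooth_on]. *)
Lemma chart_img_sub_open (p : M) U : open U ->
  open (chart p @` (chart_dom p `&` U)).
Proof.
move=> oU.
have -> : chart p @` (chart_dom p `&` U) =
    chart p @` chart_dom p `&` chart_inv p @^-1` U.
  apply/seteqP; split=> [_ [x [px Ux] <-]|y [[x px <-]]] /=.
    by split; [exists x | rewrite chartK].
  by rewrite chartK // => Ux; exists x.
rewrite openE => y [py Uy]; apply: filterI.
  by apply: open_nbhs_nbhs; split=> //; exact: chart_img_open.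
by apply: (chart_inv_continuous py); apply: open_nbhs_nbhs.
Qed.

Lemma smooth_on_sub U V f : V `<=` U -> smooth_on U f -> smooth_on V f.
Proof.
move=> VU fU p k; apply: class_C_sub (fU p k).
by apply: image_subset => x [px /VU].
Qed.

Lemma smooth_on_ext U f g : open U -> (forall x, U x -> f x = g x) ->
  smooth_on U f -> smooth_on U g.
Proof.
move=> oU fg fU p k; apply: class_C_ext (fU p k); first exact: chart_img_sub_open.
by move=> _ [x [px Ux] <-] /=; rewrite chartK //; apply: fg.
Qed.

Lemma smooth_on_cst U (c : R) : smooth_on U (fun=> c).
Proof. by move=> p k; apply: class_C_cst. Qed.

Lemma smooth_onD U f g : open U -> smooth_on U f -> smooth_on U g ->
  smooth_on U (fun x => f x + g x).
Proof.
by move=> oU fU gU p k; apply: class_CD; [exact: chart_img_sub_open|exact: fU|exact: gU].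
Qed.

Lemma smooth_onM U f g : open U -> smooth_on U f -> smooth_on U g ->
  smooth_on U (fun x => f x * g x).
Proof.
by move=> oU fU gU p k; apply: class_CM; [exact: chart_img_sub_open|exact: fU|exact: gU].
Qed.

Lemma smooth_onN U f : open U -> smooth_on U f -> smooth_on U (fun x => - f x).
Proof.
move=> oU fU; under eq_fun do rewrite -mulN1r.
by apply: smooth_onM => //; apply: smooth_on_cst.
Qed.

Lemma smooth_onB U f g : open U -> smooth_on U f -> smooth_on U g ->
  smooth_on U (fun x => f x - g x).
Proof. by move=> oU fU gU; apply: smooth_onD => //; apply: smooth_onN. Qed.

Lemma smooth_on_sum U (I : Type) (s : seq I) (F : I -> M -> R) : open U ->
  (forall i, smooth_on U (F i)) -> smooth_on U (fun x => \sum_(i <- s) F i x).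
Proof.
move=> oU FU; elim: s => [|i s IH].
  by under eq_fun do rewrite big_nil; apply: smooth_on_cst.
by under eq_fun do rewrite big_cons; apply: smooth_onD.
Qed.

End SmoothFunctionAlgebra.

(** * Alternating forms and the sharp map *)

Section AlternatingForms.
Variables (R : realType).
Implicit Types V W : vectType R.

Lemma dual_ext V (u v : V) : (forall b : dual V, b u = b v) -> u = v.
Proof.
move=> uv; rewrite (coord_vbasis (memvf u)) (coord_vbasis (memvf v)).
apply: eq_bigr => i _; congr (_ *: _).
by have := uv (linfun (coord (vbasis {:V}) i)); rewrite !lfunE.
Qed.

Lemma dual_coord_sum V n (X : n.-tuple V) (b : dual V) : basis_of fullv X ->
  b = \sum_i (b (tnth X i) : R) *: (linfun (coord X i) : dual V).
Proof.
move=> bX; apply/lfunP => u; rewrite sum_lfunE.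
rewrite {1}(coord_basis bX (memvf u)) linear_sum; apply: eq_bigr => i _.
by rewrite linearZ scale_lfunE lfunE -tnth_nth; exact: mulrC.
Qed.

Lemma pair2_eta (T : Type) (v : 'I_2 -> T) : v = pair2 (v ord0) (v (lift ord0 ord0)).
Proof.
apply/funext => -[[|[|//]] lt_i]; rewrite /pair2 (tnth_nth (v ord0)) /=;
  by congr (v _); apply: val_inj.
Qed.

Lemma pair2_comp (T T' : Type) (F : T -> T') (u v : T) :
  (fun i => F (pair2 u v i)) = pair2 (F u) (F v).
Proof. by rewrite [LHS]pair2_eta. Qed.

Lemma pair2_fun (S : Type) (T : S -> Type) (u v : forall s, T s) (s : S) :
  (fun i => pair2 u v i s) = pair2 (u s) (v s).
Proof. by rewrite [LHS]pair2_eta. Qed.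

Lemma upd_pair2l (T : Type) (u v w : T) : upd (pair2 u v) ord0 w = pair2 w v.
Proof. by rewrite [LHS]pair2_eta. Qed.

Lemma upd_pair2r (T : Type) (u v w : T) :
  upd (pair2 u v) (lift ord0 ord0) w = pair2 u w.
Proof. by rewrite [LHS]pair2_eta. Qed.

Lemma triple3_eta (T : Type) (v : 'I_3 -> T) :
  v = triple3 (v ord0) (v (lift ord0 ord0)) (v (lift ord0 (lift ord0 ord0))).
Proof.
apply/funext => -[[|[|[|//]]] lt_i]; rewrite /triple3 (tnth_nth (v ord0)) /=;
  by congr (v _); apply: val_inj.
Qed.

Section Form2.
Variables (V : vectType R) (f : ('I_2 -> V) -> R).
Hypothesis f_alt : is_alternating f.

Lemma alt2_linearl v a u w :
  f (pair2 (a *: u + w) v) = a * f (pair2 u v) + f (pair2 w v).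
Proof.
by case: f_alt => lin _; have := lin (pair2 u v) ord0 a u w; rewrite !upd_pair2l.
Qed.

Lemma alt2_linearr v a u w :
  f (pair2 v (a *: u + w)) = a * f (pair2 v u) + f (pair2 v w).
Proof.
case: f_alt => lin _; have := lin (pair2 v u) (lift ord0 ord0) a u w.
by rewrite !upd_pair2r.
Qed.

Lemma alt2_nil u : f (pair2 u u) = 0.
Proof. by case: f_alt => _ /(_ (pair2 u u) ord0 (lift ord0 ord0)); apply. Qed.

Lemma alt2_0l v : f (pair2 0 v) = 0.
Proof. by have := alt2_linearl v (-1) 0 0; rewrite scaler0 addr0; lra. Qed.

Lemma alt2_0r v : f (pair2 v 0) = 0.
Proof. by have := alt2_linearr v (-1) 0 0; rewrite scaler0 addr0; lra. Qed.

Lemma alt2Dl v u w : f (pair2 (u + w) v) = f (pair2 u v) + f (pair2 w v).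
Proof. by rewrite -{1}(scale1r u) alt2_linearl mul1r. Qed.

Lemma alt2Dr v u w : f (pair2 v (u + w)) = f (pair2 v u) + f (pair2 v w).
Proof. by rewrite -{1}(scale1r u) alt2_linearr mul1r. Qed.

Lemma alt2Zl v a u : f (pair2 (a *: u) v) = a * f (pair2 u v).
Proof. by rewrite -(addr0 (a *: u)) alt2_linearl alt2_0l addr0. Qed.

Lemma alt2Zr v a u : f (pair2 v (a *: u)) = a * f (pair2 v u).
Proof. by rewrite -(addr0 (a *: u)) alt2_linearr alt2_0r addr0. Qed.

Lemma alt2_skew u v : f (pair2 u v) = - f (pair2 v u).
Proof.
by have := alt2_nil (u + v); rewrite alt2Dl !alt2Dr !alt2_nil; lra.
Qed.

Lemma alt2Nl v u : f (pair2 (- u) v) = - f (pair2 u v).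
Proof. by rewrite -scaleN1r alt2Zl mulN1r. Qed.

Lemma alt2_suml (I : Type) (s : seq I) (c : I -> R) (u : I -> V) v :
  f (pair2 (\sum_(i <- s) c i *: u i) v) = \sum_(i <- s) c i * f (pair2 (u i) v).
Proof.
by elim: s => [|i s IH]; rewrite ?big_nil ?alt2_0l // !big_cons alt2_linearl IH.
Qed.

Lemma alt2_sumr (I : Type) (s : seq I) (c : I -> R) (u : I -> V) v :
  f (pair2 v (\sum_(i <- s) c i *: u i)) = \sum_(i <- s) c i * f (pair2 v (u i)).
Proof.
by elim: s => [|i s IH]; rewrite ?big_nil ?alt2_0r // !big_cons alt2_linearr IH.
Qed.

End Form2.

Section Sharp.
Variables (V : vectType R) (P : ('I_2 -> dual V) -> R).
Hypothesis P_alt : is_alternating P.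

(** Expanding [b] in the dual basis undoes the choice of a basis made in [sharp]. Together with
    [dual_ext], this reduces identities between vectors [sharp P a] to identities about [P]. *)
Lemma dual_sharp (a b : dual V) : b (sharp P a) = P (pair2 a b).
Proof.
rewrite /sharp linear_sum {2}(dual_coord_sum b (vbasisP fullv)) alt2_sumr //.
by apply: eq_bigr => i _; rewrite linearZ -tnth_nth; exact: mulrC.
Qed.

Lemma sharp_linear : linear (sharp P).
Proof.
move=> c a b; apply: dual_ext => d.
by rewrite linearP /= !dual_sharp alt2_linearl.
Qed.

Lemma sharp_homE (a : dual V) : sharp_hom P a = sharp P a.
Proof.
(* [linfun] agrees with a function that carries a linear structure, so one is packed for [sharp P]
   out of [sharp_linear]. *)
pose f := GRing.isLinear.Build _ _ _ _ _ sharp_linear.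
pose g : {linear dual V -> V} := HB.pack (sharp P) f.
by rewrite /sharp_hom -[sharp P]/(g : dual V -> V) lfunE.
Qed.

End Sharp.

Lemma push_alternating V W (P : ('I_2 -> dual V) -> R) (g : 'Hom(V, W)) :
  is_alternating P ->
  is_alternating (fun a : 'I_2 -> dual W => P (fun i => (a i \o g)%VF)).
Proof.
move=> [lin alt]; split=> [v i c u w|v i j ij vij]; last first.
  by apply: alt ij _ => /=; rewrite vij.
have E (z : dual W) : (fun k => (upd v i z k \o g)%VF) =
    upd (fun k => (v k \o g)%VF) i ((z \o g)%VF : dual V).
  by apply/funext => k; rewrite /upd; case: ifP.
rewrite !E -lin; congr (P (upd _ _ _)).
by rewrite comp_lfunDl comp_lfunZl.
Qed.

End AlternatingForms.

(** * Smooth sections, anchor and bracket *)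

Section SmoothSections.
Variables (R : realType) (M : manifold R).
Implicit Types (E F : vbundle M) (U V : set M).

Lemma smooth_section_sub E U V (X : section E) :
  V `<=` U -> smooth_section U X -> smooth_section V X.
Proof.
move=> VU XU p j; apply: smooth_on_sub (XU p j).
by move=> x [/VU].
Qed.

Lemma smooth_sectionD E U (X Y : section E) : open U ->
  smooth_section U X -> smooth_section U Y ->
  smooth_section U (fun x => X x + Y x : E x).
Proof.
move=> oU XU YU p j; under eq_fun do rewrite linearD.
by apply: smooth_onD; [apply: openI => //; exact: frame_dom_open|exact: XU|exact: YU].
Qed.

Lemma smooth_sectionZ E U (f : M -> R) (X : section E) : open U ->
  smooth_on U f -> smooth_section U X ->
  smooth_section U (fun x => f x *: X x : E x).
Proof.
move=> oU fU XU p j; under eq_fun do rewrite linearZ.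
apply: smooth_onM; [by apply: openI => //; exact: frame_dom_open| |exact: XU].
by apply: smooth_on_sub fU => x [].
Qed.

Lemma smooth_section0 E U : smooth_section U (fun x => 0 : E x).
Proof.
by move=> p j; under eq_fun do rewrite linear0; exact: smooth_on_cst.
Qed.

Lemma smooth_section_sum E U (I : Type) (s : seq I) (X : I -> section E) :
  open U -> (forall i, smooth_section U (X i)) ->
  smooth_section U (fun x => \sum_(i <- s) X i x : E x).
Proof.
move=> oU XU p j; under eq_fun do rewrite linear_sum.
apply: smooth_on_sum => [|i]; last exact: XU.
by apply: openI => //; exact: frame_dom_open.
Qed.

Lemma smooth_frame E (p : M) i :
  smooth_section (frame_dom E p) (fun x => tnth (frame E p x) i).
Proof. by move=> q j; exact: frame_transition. Qed.

Lemma frame_sum E (p x : M) (u : E x) : frame_dom E p x ->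
  u = \sum_l coord (frame E p x) l u *: tnth (frame E p x) l.
Proof.
move=> px; rewrite {1}(coord_basis (frame_basis px) (memvf u)).
by apply: eq_bigr => l _; rewrite -tnth_nth.
Qed.

Lemma smooth_cosection_sub E U V (a : cosection E) :
  V `<=` U -> smooth_cosection U a -> smooth_cosection V a.
Proof. by move=> VU aU W X oW WV; apply: aU => // x /WV /VU. Qed.

Lemma smooth_pairing E U (a : cosection E) (X : section E) : open U ->
  smooth_cosection U a -> smooth_section U X -> smooth_on U (fun x => a x (X x)).
Proof. by move=> oU aU; apply: aU. Qed.

Lemma smooth_coord E (p : M) j : smooth_cosection (frame_dom E p)
  (fun x => linfun (coord (frame E p x) j) : dual (E x)).
Proof.
move=> U X oU Up XU; under eq_fun do rewrite lfunE.
by apply: smooth_on_sub (XU p j) => x Ux; split=> //; exact: Up.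
Qed.

(** Counterpart of [extend] for covectors, constant in the dual frame: a covector at one point
    becomes the value of a local section, to which the rules for anchor and bracket apply. *)
Definition coextend E (x : M) (a : dual (E x)) : cosection E :=
  fun y => \sum_i (a (tnth (frame E x x) i) : R)
             *: (linfun (coord (frame E x y) i) : dual (E y)).

Lemma coextend_at E (x : M) (a : dual (E x)) : coextend a x = a.
Proof.
by rewrite [RHS](dual_coord_sum a (frame_basis (frame_dom_mem E x))).
Qed.

Lemma coextend_smooth E (x : M) (a : dual (E x)) :
  smooth_cosection (frame_dom E x) (coextend a).
Proof.
move=> U X oU Ux XU.
have -> : (fun y => coextend a y (X y)) = fun y =>
    \sum_i (a (tnth (frame E x x) i) : R) * coord (frame E x y) i (X y).
  apply/funext => y; rewrite /coextend sum_lfunE; apply: eq_bigr => i _.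
  by rewrite scale_lfunE lfunE.
apply: smooth_on_sum => // i; apply: smooth_onM => //; first exact: smooth_on_cst.
by apply: smooth_on_sub (XU x i) => y Uy; split=> //; exact: Ux.
Qed.

Lemma smooth_form2 E (w : kform E 2) U (X Y : section E) : is_kform w -> open U ->
  smooth_section U X -> smooth_section U Y ->
  smooth_on U (fun x => w x (pair2 (X x) (Y x))).
Proof.
move=> [_ wU] oU XU YU.
have := wU U (pair2 X Y) oU; under eq_fun do rewrite pair2_fun.
by apply=> -[[|[|//]] ?]; rewrite /pair2 (tnth_nth X).
Qed.

Lemma smooth_vector2 E (P : kvector E 2) U (a b : cosection E) : is_kvector P ->
  open U -> smooth_cosection U a -> smooth_cosection U b ->
  smooth_on U (fun x => P x (pair2 (a x) (b x))).
Proof.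
move=> [_ PU] oU aU bU.
have := PU U (pair2 a b) oU; under eq_fun do rewrite pair2_fun.
by apply=> -[[|[|//]] ?]; rewrite /pair2 (tnth_nth a).
Qed.

(** The coordinates of P^sharp a in a frame are the values of [P] on [a] and on the coordinate
    covectors, which are themselves smooth. *)
Lemma smooth_sharp E (P : kvector E 2) U (a : cosection E) : is_kvector P ->
  open U -> smooth_cosection U a ->
  smooth_section U (fun x => sharp (P x) (a x)).
Proof.
move=> Pv oU aU q j.
have -> : (fun x => coord (frame E q x) j (sharp (P x) (a x))) = fun x =>
    P x (pair2 (a x) (linfun (coord (frame E q x) j) : dual (E x))).
  by apply/funext => x; case: Pv => Pa _; rewrite -(dual_sharp (Pa x)) lfunE.
apply: (@smooth_vector2 E P _ a (fun x => linfun (coord (frame E q x) j))) => //.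
- by apply: openI => //; exact: frame_dom_open.
- exact: (smooth_cosection_sub (@subIsetl _ _ _) aU).
- exact: (smooth_cosection_sub (@subIsetr _ _ _) (@smooth_coord E q j)).
Qed.

End SmoothSections.

(** * Local calculus of the anchor and of the bracket at a point *)

Section LieAlgebroidCalculus.
Variables (R : realType) (M : manifold R) (A : lie_algebroid M).
Implicit Types (X Y Z : section A) (f g : M -> R).

Lemma extend_at (x : M) (u : A x) : extend u x = u.
Proof. by rewrite [RHS](frame_sum u (frame_dom_mem A x)). Qed.

Lemma extend_smooth (x : M) (u : A x) :
  smooth_section (frame_dom A x) (extend u).
Proof.
apply: smooth_section_sum => [|l]; first exact: frame_dom_open.
apply: smooth_sectionZ; [exact: frame_dom_open|exact: smooth_on_cst|].
exact: smooth_frame.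
Qed.

Lemma extend_linear (x : M) a (u v : A x) :
  extend (a *: u + v) = fun y => a *: extend u y + extend v y : A y.
Proof.
apply: functional_extensionality_dep => y; rewrite /extend scaler_sumr -big_split.
apply: eq_bigr => l _.
by rewrite linearP scalerDl scalerA.
Qed.

Variables (U : set M) (x : M).
Hypotheses (oU : open U) (Ux : U x).

Lemma anchor_ext (u : A x) f g : smooth_on U f -> (forall y, U y -> f y = g y) ->
  anchor A x u f = anchor A x u g.
Proof.
move=> fU fg; have gU := smooth_on_ext oU fg fU.
by have [_ _] := anchor_tangent u oU Ux fU gU; apply.
Qed.

Lemma anchorD (u : A x) f g : smooth_on U f -> smooth_on U g ->
  anchor A x u (fun y => f y + g y) = anchor A x u f + anchor A x u g.
Proof.
move=> fU gU; have [/(_ 1) + _ _] := anchor_tangent u oU Ux fU gU.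
by rewrite mul1r; under [X in anchor _ _ _ X = _]eq_fun do rewrite mul1r.
Qed.

Lemma anchorM (u : A x) f g : smooth_on U f -> smooth_on U g ->
  anchor A x u (fun y => f y * g y) = anchor A x u f * g x + f x * anchor A x u g.
Proof. by move=> fU gU; have [] := anchor_tangent u oU Ux fU gU. Qed.

Lemma anchor0 (u : A x) : anchor A x u (fun=> 0) = 0.
Proof.
have s0 := @smooth_on_cst R M U 0.
by have := anchorD u s0 s0; under [X in anchor _ _ _ X = _]eq_fun do rewrite addr0; lra.
Qed.

Lemma anchorN (u : A x) f : smooth_on U f ->
  anchor A x u (fun y => - f y) = - anchor A x u f.
Proof.
move=> fU; have := anchorD u fU (smooth_onN oU fU).
by under [X in anchor _ _ _ X = _]eq_fun do rewrite subrr; rewrite anchor0; lra.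
Qed.

Lemma anchorB (u : A x) f g : smooth_on U f -> smooth_on U g ->
  anchor A x u (fun y => f y - g y) = anchor A x u f - anchor A x u g.
Proof.
by move=> fU gU; rewrite anchorD ?anchorN //; exact: smooth_onN.
Qed.

Lemma anchor_sum (u : A x) (I : Type) (s : seq I) (F : I -> M -> R) :
  (forall i, smooth_on U (F i)) ->
  anchor A x u (fun y => \sum_(i <- s) F i y) = \sum_(i <- s) anchor A x u (F i).
Proof.
move=> FU; elim: s => [|i s IH].
  by under eq_fun do rewrite big_nil; rewrite big_nil anchor0.
under eq_fun do rewrite big_cons; rewrite big_cons -IH -anchorD //.
exact: smooth_on_sum.
Qed.

Lemma anchorPl (u v : A x) a f : smooth_on U f ->
  anchor A x (a *: u + v) f = a * anchor A x u f + anchor A x v f.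
Proof. exact: anchor_linear. Qed.

Lemma anchorDl (u v : A x) f : smooth_on U f ->
  anchor A x (u + v) f = anchor A x u f + anchor A x v f.
Proof. by move=> fU; rewrite -{1}(scale1r u) anchorPl // mul1r. Qed.

Lemma anchor0l f : smooth_on U f -> anchor A x (0 : A x) f = 0.
Proof. by move=> fU; have := anchorDl 0 0 fU; rewrite addr0; lra. Qed.

Lemma anchorZl (u : A x) a f : smooth_on U f ->
  anchor A x (a *: u) f = a * anchor A x u f.
Proof. by move=> fU; rewrite -(addr0 (a *: u)) anchorPl // anchor0l // addr0. Qed.

Lemma anchor_suml (I : Type) (s : seq I) (u : I -> A x) f : smooth_on U f ->
  anchor A x (\sum_(i <- s) u i) f = \sum_(i <- s) anchor A x (u i) f.
Proof.
move=> fU; elim: s => [|i s IH]; first by rewrite !big_nil anchor0l.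
by rewrite !big_cons anchorDl // IH.
Qed.

Lemma bracketDl X Y Z : smooth_section U X -> smooth_section U Y ->
  smooth_section U Z ->
  bracket A (fun y => X y + Y y : A y) Z x = bracket A X Z x + bracket A Y Z x.
Proof.
move=> XU YU ZU; have := bracket_linear 1 oU XU YU ZU Ux.
rewrite scale1r => <-; congr (bracket A _ Z x).
by apply: functional_extensionality_dep => y; rewrite scale1r.
Qed.

Lemma bracketDr X Y Z : smooth_section U X -> smooth_section U Y ->
  smooth_section U Z ->
  bracket A Z (fun y => X y + Y y : A y) x = bracket A Z X x + bracket A Z Y x.
Proof.
move=> XU YU ZU; rewrite (bracket_skew oU ZU (smooth_sectionD oU XU YU) Ux).
by rewrite bracketDl // opprD -!(bracket_skew oU).
Qed.

Lemma bracketZr X Y f : smooth_section U X -> smooth_section U Y ->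
  smooth_on U f ->
  bracket A X (fun y => f y *: Y y : A y) x
    = f x *: bracket A X Y x + anchor A x (X x) f *: Y x.
Proof. by move=> XU YU fU; exact: bracket_leibniz Ux. Qed.

Lemma bracketZl X Y f : smooth_section U X -> smooth_section U Y ->
  smooth_on U f ->
  bracket A (fun y => f y *: Y y : A y) X x
    = f x *: bracket A Y X x - anchor A x (X x) f *: Y x.
Proof.
move=> XU YU fU; rewrite (bracket_skew oU (smooth_sectionZ oU fU YU) XU Ux).
by rewrite bracketZr // opprD -scalerN -(bracket_skew oU).
Qed.

Lemma bracket0l X : smooth_section U X -> bracket A (fun y => 0 : A y) X x = 0.
Proof.
move=> XU; have s0 := @smooth_section0 R M A U.
have := bracketDl s0 s0 XU.
have -> : (fun y => 0 + 0 : A y) = fun y => 0 : A y.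
  by apply: functional_extensionality_dep => y; rewrite addr0.
by move=> /esym/eqP; rewrite -subr_eq0 addrK => /eqP.
Qed.

Lemma bracket0r X : smooth_section U X -> bracket A X (fun y => 0 : A y) x = 0.
Proof.
move=> XU; rewrite (bracket_skew oU XU (@smooth_section0 R M A U) Ux).
by rewrite bracket0l // oppr0.
Qed.

Lemma bracketNl X Y : smooth_section U X -> smooth_section U Y ->
  bracket A (fun y => - X y : A y) Y x = - bracket A X Y x.
Proof.
move=> XU YU; have := bracket_linear (-1) oU XU (@smooth_section0 R M A U) YU Ux.
rewrite bracket0l // addr0 scaleN1r => <-; congr (bracket A _ Y x).
by apply: functional_extensionality_dep => y; rewrite addr0 scaleN1r.
Qed.

Lemma bracket_sum (I J : Type) (s : seq I) (t : seq J) (X : I -> section A)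
    (Y : J -> section A) :
  (forall i, smooth_section U (X i)) -> (forall j, smooth_section U (Y j)) ->
  bracket A (fun y => \sum_(i <- s) X i y : A y)
            (fun y => \sum_(j <- t) Y j y : A y) x
    = \sum_(i <- s) \sum_(j <- t) bracket A (X i) (Y j) x.
Proof.
move=> XU YU; have tU := smooth_section_sum t oU YU.
elim: s => [|i s IH].
  rewrite big_nil; have -> : (fun y => \sum_(i <- [::]) X i y) = fun y => 0 : A y.
    by apply: functional_extensionality_dep => y; rewrite big_nil.
  by rewrite bracket0l.
rewrite big_cons -IH.
have -> : (fun y => \sum_(k <- i :: s) X k y) =
    fun y => X i y + \sum_(k <- s) X k y.
  by apply: functional_extensionality_dep => y; rewrite big_cons.
rewrite bracketDl //; last exact: smooth_section_sum.
congr (_ + _); elim: t {IH tU} => [|j t IH].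
  rewrite big_nil; have -> : (fun y => \sum_(j <- [::]) Y j y) = fun y => 0 : A y.
    by apply: functional_extensionality_dep => y; rewrite big_nil.
  by rewrite bracket0r.
rewrite big_cons -IH.
have -> : (fun y => \sum_(k <- j :: t) Y k y) =
    fun y => Y j y + \sum_(k <- t) Y k y.
  by apply: functional_extensionality_dep => y; rewrite big_cons.
by rewrite bracketDr //; exact: smooth_section_sum.
Qed.

End LieAlgebroidCalculus.

(** * The differential of a 2-form *)

Section KoszulExpansion.
Variables (R : realType) (M : manifold R) (A : lie_algebroid M).

(** The degree 2 case of [koszul], written out so that the three sections can be varied one at a
    time; they are arbitrary, whereas [dA] is tied to the sections [extend]. *)
Definition koszul2 (w : kform A 2) (X Y Z : section A) (x : M) : R :=
  anchor A x (X x) (fun y => w y (pair2 (Y y) (Z y)))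
  - anchor A x (Y x) (fun y => w y (pair2 (X y) (Z y)))
  + anchor A x (Z x) (fun y => w y (pair2 (X y) (Y y)))
  - w x (pair2 (bracket A X Y x) (Z x))
  + w x (pair2 (bracket A X Z x) (Y x))
  - w x (pair2 (bracket A Y Z x) (X x)).

Lemma koszul2E (w : kform A 2) (X : 'I_3 -> section A) (x : M) :
  koszul w X x =
    koszul2 w (X ord0) (X (lift ord0 ord0)) (X (lift ord0 (lift ord0 ord0))) x.
Proof.
(* Writing [w] through a function [W] of two separate arguments makes it depend on the entries of a
   family only, so that the families built by [koszul] with [lift] and [nth] simplify entry by
   entry. *)
have [W ->] : exists W : forall y, A y -> A y -> R,
    w = fun y v => W y (v ord0) (v (lift ord0 ord0)).
  exists (fun y u v => w y (pair2 u v)); apply: functional_extensionality_dep => y.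
  by apply/funext => v; rewrite {1}[v]pair2_eta.
rewrite /koszul /koszul2 (eq_bigr _ (fun i _ => big_mkcond _ _)).
rewrite !enum_ordSl enum_ord0 /= !big_ord_recl !big_ord0 /=.
have -> : lift (lift ord0 ord0) ord0 = ord0 :> 'I_3 by apply: val_inj.
have -> : lift (lift ord0 (lift ord0 ord0)) ord0 = ord0 :> 'I_3 by apply: val_inj.
have -> : lift (lift ord0 (lift ord0 ord0)) (lift ord0 ord0) = lift ord0 ord0 :> 'I_3
  by apply: val_inj.
have -> : lift (lift ord0 ord0) (lift ord0 ord0) = lift ord0 (lift ord0 ord0) :> 'I_3
  by apply: val_inj.
by rewrite /bump /= /pair2 !(tnth_nth (0 : A _)) /=; ring.
Qed.

Definition koszul3 (w : kform A 3) (X Y Z T : section A) (x : M) : R :=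
  anchor A x (X x) (fun y => w y (triple3 (Y y) (Z y) (T y)))
  - anchor A x (Y x) (fun y => w y (triple3 (X y) (Z y) (T y)))
  + anchor A x (Z x) (fun y => w y (triple3 (X y) (Y y) (T y)))
  - anchor A x (T x) (fun y => w y (triple3 (X y) (Y y) (Z y)))
  - w x (triple3 (bracket A X Y x) (Z x) (T x))
  + w x (triple3 (bracket A X Z x) (Y x) (T x))
  - w x (triple3 (bracket A X T x) (Y x) (Z x))
  - w x (triple3 (bracket A Y Z x) (X x) (T x))
  + w x (triple3 (bracket A Y T x) (X x) (Z x))
  - w x (triple3 (bracket A Z T x) (X x) (Y x)).

Lemma koszul3E (w : kform A 3) (X : 'I_4 -> section A) (x : M) :
  koszul w X x =
    koszul3 w (X ord0) (X (lift ord0 ord0)) (X (lift ord0 (lift ord0 ord0)))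
      (X (lift ord0 (lift ord0 (lift ord0 ord0)))) x.
Proof.
have [W ->] : exists W : forall y, A y -> A y -> A y -> R,
    w = fun y v => W y (v ord0) (v (lift ord0 ord0)) (v (lift ord0 (lift ord0 ord0))).
  exists (fun y u v z => w y (triple3 u v z)); apply: functional_extensionality_dep => y.
  by apply/funext => v; rewrite {1}[v]triple3_eta.
rewrite /koszul /koszul3 (eq_bigr _ (fun i _ => big_mkcond _ _)).
rewrite !enum_ordSl enum_ord0 /= !big_ord_recl !big_ord0 /=.
pose i0 : 'I_4 := ord0; pose i1 : 'I_4 := lift ord0 ord0.
pose i2 : 'I_4 := lift ord0 (lift ord0 ord0).
pose i3 : 'I_4 := lift ord0 (lift ord0 (lift ord0 ord0)).
have -> : lift i1 ord0 = i0 by apply: val_inj.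
have -> : lift i1 (lift ord0 ord0) = i2 by apply: val_inj.
have -> : lift i1 (lift ord0 (lift ord0 ord0)) = i3 by apply: val_inj.
have -> : lift i2 ord0 = i0 by apply: val_inj.
have -> : lift i2 (lift ord0 ord0) = i1 by apply: val_inj.
have -> : lift i2 (lift ord0 (lift ord0 ord0)) = i3 by apply: val_inj.
have -> : lift i3 ord0 = i0 by apply: val_inj.
have -> : lift i3 (lift ord0 ord0) = i1 by apply: val_inj.
have -> : lift i3 (lift ord0 (lift ord0 ord0)) = i2 by apply: val_inj.
by rewrite /bump /= /triple3 !(tnth_nth (0 : A _)) /=; ring.
Qed.

End KoszulExpansion.

Ltac prove_smooth := repeat first
  [ assumption | exact: smooth_on_cst | exact: smooth_section0
  | apply: smooth_onD | apply: smooth_onB | apply: smooth_onN | apply: smooth_onM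
  | apply: smooth_form2 | apply: anchor_smooth | apply: bracket_smooth
  | apply: smooth_sectionD | apply: smooth_sectionZ ].

(** * Tensoriality of the Koszul formula *)

Section Tensoriality.
Variables (R : realType) (M : manifold R) (A : lie_algebroid M).
Variable w : kform A 2.
Arguments w : clear implicits.
Hypothesis w_form : is_kform w.
Implicit Types (U V : set M) (X Y Z T : section A).

Lemma koszul2_smooth U X Y Z : open U -> smooth_section U X ->
  smooth_section U Y -> smooth_section U Z -> smooth_on U (koszul2 w X Y Z).
Proof. by move=> oU XU YU ZU; rewrite /koszul2; prove_smooth. Qed.

Section AtPoint.
Variables (U : set M) (x : M) (oU : open U) (Ux : U x).

Lemma koszul2_swapl X Y Z : smooth_section U X -> smooth_section U Y ->
  smooth_section U Z -> koszul2 w X Y Z x = - koszul2 w Y X Z x.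
Proof.
have [w_alt _] := w_form; move=> XU YU ZU; rewrite /koszul2.
rewrite (bracket_skew oU YU XU Ux) (alt2Nl (w_alt x)).
rewrite (_ : (fun y => w y (pair2 (Y y) (X y))) = fun y => - w y (pair2 (X y) (Y y))).
  by rewrite (anchorN oU Ux); [ring|prove_smooth].
by apply/funext => y; exact: alt2_skew.
Qed.

Lemma koszul2_swapr X Y Z : smooth_section U X -> smooth_section U Y ->
  smooth_section U Z -> koszul2 w X Y Z x = - koszul2 w X Z Y x.
Proof.
have [w_alt _] := w_form; move=> XU YU ZU; rewrite /koszul2.
rewrite (bracket_skew oU ZU YU Ux) (alt2Nl (w_alt x)).
rewrite (_ : (fun y => w y (pair2 (Z y) (Y y))) = fun y => - w y (pair2 (Y y) (Z y))).
  by rewrite (anchorN oU Ux); [ring|prove_smooth].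
by apply/funext => y; exact: alt2_skew.
Qed.

Lemma koszul2_extl X X' Y Z : smooth_section U X -> smooth_section U X' ->
  smooth_section U Y -> smooth_section U Z -> (forall y, U y -> X y = X' y) ->
  koszul2 w X Y Z x = koszul2 w X' Y Z x.
Proof.
move=> XU XU' YU ZU XX'; rewrite /koszul2 -(XX' x Ux).
rewrite (bracket_local oU XU YU XX' (fun _ _ => erefl) Ux).
rewrite (bracket_local oU XU ZU XX' (fun _ _ => erefl) Ux).
rewrite (@anchor_ext _ _ _ _ _ oU Ux _ (fun y => w y (pair2 (X y) (Z y)))
  (fun y => w y (pair2 (X' y) (Z y)))); first last.
- by move=> y /XX' ->.
- by prove_smooth.
rewrite (@anchor_ext _ _ _ _ _ oU Ux _ (fun y => w y (pair2 (X y) (Y y)))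
  (fun y => w y (pair2 (X' y) (Y y)))) //.
- by prove_smooth.
- by move=> y /XX' ->.
Qed.

Lemma koszul2Dl X X' Y Z : smooth_section U X -> smooth_section U X' ->
  smooth_section U Y -> smooth_section U Z ->
  koszul2 w (fun y => X y + X' y : A y) Y Z x
    = koszul2 w X Y Z x + koszul2 w X' Y Z x.
Proof.
have [w_alt _] := w_form; move=> XU XU' YU ZU; rewrite /koszul2.
have D (T : section A) : (fun y => w y (pair2 (X y + X' y) (T y))) =
    fun y => w y (pair2 (X y) (T y)) + w y (pair2 (X' y) (T y)).
  by apply/funext => y; exact: alt2Dl.
rewrite !D !(anchorD oU Ux) ?(anchorDl oU Ux); try by prove_smooth.
by rewrite !(bracketDl oU Ux) // !(alt2Dl (w_alt x)) (alt2Dr (w_alt x)); ring.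
Qed.

(** The derivatives of [f] coming from rho(Y)(f w(X, Z)) and rho(Z)(f w(X, Y)) cancel those that the
    Leibniz rule produces in the brackets [f X, Y] and [f X, Z]. *)
Lemma koszul2Zl f X Y Z : smooth_on U f -> smooth_section U X ->
  smooth_section U Y -> smooth_section U Z ->
  koszul2 w (fun y => f y *: X y : A y) Y Z x = f x * koszul2 w X Y Z x.
Proof.
have [w_alt _] := w_form; move=> fU XU YU ZU; rewrite /koszul2.
have D (T : section A) : (fun y => w y (pair2 (f y *: X y) (T y))) =
    fun y => f y * w y (pair2 (X y) (T y)).
  by apply/funext => y; exact: alt2Zl.
rewrite !D !(anchorM oU Ux) ?(anchorZl oU Ux); try by prove_smooth.
rewrite !(bracketZl oU Ux) // !(alt2Dl (w_alt x)) !(alt2Nl (w_alt x)).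
rewrite !(alt2Zl (w_alt x)) !(alt2Zr (w_alt x)).
by rewrite (alt2_skew (w_alt x) (bracket A Y Z x)); ring.
Qed.

Lemma koszul2_suml (I : Type) (s : seq I) (f : I -> M -> R)
    (X : I -> section A) Y Z :
  (forall i, smooth_on U (f i)) -> (forall i, smooth_section U (X i)) ->
  smooth_section U Y -> smooth_section U Z ->
  koszul2 w (fun y => \sum_(i <- s) f i y *: X i y : A y) Y Z x
    = \sum_(i <- s) f i x * koszul2 w (X i) Y Z x.
Proof.
move=> fU XU YU ZU; elim: s => [|i s IH].
  rewrite big_nil.
  (* The empty sum is presented as a multiple of the smooth section [Y] with coefficient zero, which
     [koszul2Zl] handles. *)
  have -> : (fun y => \sum_(i <- [::]) f i y *: X i y) = fun y => 0 *: Y y : A y.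
    by apply: functional_extensionality_dep => y; rewrite big_nil scale0r.
  by rewrite (koszul2Zl (f := fun=> 0)) ?mul0r; prove_smooth.
rewrite big_cons -IH -koszul2Zl //.
have -> : (fun y => \sum_(k <- i :: s) f k y *: X k y) =
    fun y => f i y *: X i y + \sum_(k <- s) f k y *: X k y : A y.
  by apply: functional_extensionality_dep => y; rewrite big_cons.
rewrite koszul2Dl //; first by prove_smooth.
by apply: smooth_section_sum => // k; prove_smooth.
Qed.

Lemma koszul2_nil12 X Z : smooth_section U X -> smooth_section U Z ->
  koszul2 w X X Z x = 0.
Proof. by move=> XU ZU; have := koszul2_swapl XU XU ZU; lra. Qed.

Lemma koszul2_nil23 X Z : smooth_section U X -> smooth_section U Z ->
  koszul2 w Z X X x = 0.
Proof. by move=> XU ZU; have := koszul2_swapr ZU XU XU; lra. Qed.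

Lemma koszul2_nil13 X Z : smooth_section U X -> smooth_section U Z ->
  koszul2 w X Z X x = 0.
Proof. by move=> XU ZU; rewrite koszul2_swapr // koszul2_nil12 // oppr0. Qed.

End AtPoint.

(** Near [x] a section is a combination of the frame with smooth coefficients; linearity over
    functions leaves only the values of these coefficients at [x]. *)
Lemma koszul2_tensorl U x X X' Y Z : open U -> U x -> smooth_section U X ->
  smooth_section U X' -> smooth_section U Y -> smooth_section U Z ->
  X x = X' x -> koszul2 w X Y Z x = koszul2 w X' Y Z x.
Proof.
move=> oU Ux XU XU' YU ZU XX'; pose V := U `&` frame_dom A x.
have oV : open V by apply: openI => //; exact: frame_dom_open.
have Vx : V x by split=> //; exact: frame_dom_mem.
have VU T : smooth_section U T -> smooth_section V T.
  by apply: smooth_section_sub => y [].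
have eV i : smooth_section V (fun y => tnth (frame A x y) i).
  by apply: smooth_section_sub (@smooth_frame _ _ A x i) => y [].
have cV T i : smooth_section U T -> smooth_on V (fun y => coord (frame A x y) i (T y)).
  by move=> TU; exact: TU.
have E T : smooth_section U T -> koszul2 w T Y Z x =
    \sum_i coord (frame A x x) i (T x) * koszul2 w (fun y => tnth (frame A x y) i) Y Z x.
  move=> TU.
  rewrite -(koszul2_suml oV Vx (index_enum 'I_(rk A))
    (fun i => cV T i TU) eV (VU _ YU) (VU _ ZU)).
  apply: (koszul2_extl oV Vx); [exact: VU| |exact: VU|exact: VU|].
    by apply: smooth_section_sum => // i; apply: smooth_sectionZ => //; exact: cV.
  by move=> y [_ xy]; exact: frame_sum.
by rewrite (E X) // (E X') // XX'.
Qed.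

Lemma koszul2_tensor U x X X' Y Y' Z Z' : open U -> U x ->
  smooth_section U X -> smooth_section U X' ->
  smooth_section U Y -> smooth_section U Y' ->
  smooth_section U Z -> smooth_section U Z' ->
  X x = X' x -> Y x = Y' x -> Z x = Z' x ->
  koszul2 w X Y Z x = koszul2 w X' Y' Z' x.
Proof.
move=> oU Ux XU XU' YU YU' ZU ZU' XX' YY' ZZ'.
rewrite (koszul2_tensorl oU Ux XU XU' YU ZU XX').
rewrite (koszul2_swapl oU Ux XU' YU ZU) (koszul2_tensorl oU Ux YU YU' XU' ZU YY').
rewrite -(koszul2_swapl oU Ux XU' YU' ZU) (koszul2_swapr oU Ux XU' YU' ZU).
rewrite (koszul2_swapl oU Ux XU' ZU YU') (koszul2_tensorl oU Ux ZU ZU' XU' YU' ZZ').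
by rewrite -(koszul2_swapl oU Ux XU' ZU' YU') -(koszul2_swapr oU Ux XU' YU' ZU').
Qed.

(** By tensoriality, the constant-coordinate extensions inside [dA] can be traded for any smooth
    sections with the same values at [x]. Smoothness and closedness of d_A w, and its evaluation on
    sections Q^sharp a, all rest on this. *)
Lemma dA2E U x (v : 'I_3 -> A x) X Y Z : open U -> U x ->
  smooth_section U X -> smooth_section U Y -> smooth_section U Z ->
  X x = v ord0 -> Y x = v (lift ord0 ord0) ->
  Z x = v (lift ord0 (lift ord0 ord0)) ->
  dA w x v = koszul2 w X Y Z x.
Proof.
move=> oU Ux XU YU ZU Xx Yx Zx; rewrite /dA koszul2E.
pose V := U `&` frame_dom A x.
have oV : open V by apply: openI => //; exact: frame_dom_open.
have Vx : V x by split=> //; exact: frame_dom_mem.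
have VU T : smooth_section U T -> smooth_section V T.
  by apply: smooth_section_sub => y [].
have eV u : smooth_section V (@extend _ _ A x u).
  by apply: smooth_section_sub (extend_smooth u) => y [].
by apply: (koszul2_tensor oV Vx); rewrite ?extend_at //; exact: VU.
Qed.

Lemma is_kform_dA : is_kform (dA w).
Proof.
split=> [x|U X oU XU]; last first.
  (* [dA] extends its arguments in a frame that changes with the point; [dA2E] replaces it by the
     Koszul expression of the fixed sections [X i], which is smooth. *)
  apply: (smooth_on_ext oU _ (koszul2_smooth oU (XU ord0)
    (XU (lift ord0 ord0)) (XU (lift ord0 (lift ord0 ord0))))) => y Uy.
  by rewrite (dA2E oU Uy (XU _) (XU _) (XU _) erefl erefl erefl).
have oF := frame_dom_open A x; have Fx := frame_dom_mem A x.
have eF (u : A x) := extend_smooth u.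
(* Linearity is established in the first slot; the swaps below carry it to the other two. *)
have linl a (u u' v z : A x) :
    koszul2 w (extend (a *: u + u')) (extend v) (extend z) x =
    a * koszul2 w (extend u) (extend v) (extend z) x
      + koszul2 w (extend u') (extend v) (extend z) x.
  rewrite extend_linear (koszul2Dl oF Fx) //.
    by rewrite (koszul2Zl oF Fx (f := fun=> a)) //; exact: smooth_on_cst.
  by apply: smooth_sectionZ => //; exact: smooth_on_cst.
have dE (v : 'I_3 -> A x) : dA w x v =
    koszul2 w (extend (v ord0)) (extend (v (lift ord0 ord0)))
      (extend (v (lift ord0 (lift ord0 ord0)))) x by rewrite /dA koszul2E.
have swl := koszul2_swapl oF Fx; have swr := koszul2_swapr oF Fx.
have I3 (i : 'I_3) : [\/ i = ord0, i = lift ord0 ord0 | i = lift ord0 (lift ord0 ord0)].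
  by case: i => [[|[|[|//]]] ?]; [apply: Or31|apply: Or32|apply: Or33]; apply: val_inj.
split=> [v i a u u'|v i j].
  rewrite !dE; have [->|->|->] := I3 i; rewrite /upd /=.
  - exact: linl.
  - rewrite swl // linl [in RHS]swl // [X in _ = _ + X]swl //; ring.
  - rewrite swr // swl // linl [in RHS]swr // [X in _ = _ * - X + _]swl //.
    by rewrite [X in _ = _ + X]swr // [X in _ = _ - X]swl //; ring.
rewrite dE; have [->|->|->] := I3 i; have [->|->|->] := I3 j => //= _ ->.
- exact: (koszul2_nil12 oF Fx).
- exact: (koszul2_nil13 oF Fx).
- exact: (koszul2_nil12 oF Fx).
- exact: (koszul2_nil23 oF Fx).
- exact: (koszul2_nil13 oF Fx).
- exact: (koszul2_nil23 oF Fx).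
Qed.

End Tensoriality.

Lemma is_kformN (R : realType) (M : manifold R) (E : vbundle M) k (w : kform E k) :
  is_kform w -> is_kform (fun x v => - w x v).
Proof.
move=> [w_alt w_smooth]; split=> [x|U X oU XU]; last first.
  by apply: smooth_onN => //; exact: w_smooth.
have [lin alt] := w_alt x; split=> [v i a u u'|v i j ij vij].
  by rewrite lin opprD mulrN.
by rewrite (alt v i j) // oppr0.
Qed.

(** * The differential squares to zero on 2-forms *)

Section SquareZero.
Variables (R : realType) (M : manifold R) (A : lie_algebroid M).
Variable w : kform A 2.
Arguments w : clear implicits.
Hypothesis w_form : is_kform w.
Variables (U : set M) (x : M) (oU : open U) (Ux : U x).
Implicit Types (X Y Z T : section A).

(** The Jacobi identity as a rewriting rule for brackets nested on the left, the shape that the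
    iterated Koszul formula produces. *)
Lemma bracket_jacobi_left X Y Z : smooth_section U X -> smooth_section U Y ->
  smooth_section U Z ->
  bracket A (bracket A X Y) Z x
    = bracket A (bracket A X Z) Y x - bracket A (bracket A Y Z) X x.
Proof.
move=> XU YU ZU; have := bracket_jacobi oU XU YU ZU Ux.
have b (S T : section A) : smooth_section U S -> smooth_section U T ->
  smooth_section U (bracket A S T) by move=> *; exact: bracket_smooth.
rewrite (bracket_skew oU XU (b _ _ YU ZU) Ux) (bracket_skew oU ZU (b _ _ XU YU) Ux).
(* The equality [Z, X] = - [X, Z] is known on [U] only, so its use inside the outer bracket goes
   through [bracket_local]. *)
have -> : bracket A Y (bracket A Z X) x = bracket A (bracket A X Z) Y x.
  rewrite (bracket_skew oU YU (b _ _ ZU XU) Ux) -[RHS]opprK.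
  rewrite -(bracketNl oU Ux (b _ _ XU ZU) YU).
  congr (- _); apply: (bracket_local oU (b _ _ ZU XU) YU _ _ Ux) => // y Uy.
  exact: bracket_skew Uy.
by move/eqP; rewrite subr_eq0 addrC => /eqP <-.
Qed.

Lemma anchor_koszul2 (u : A x) X Y Z : smooth_section U X ->
  smooth_section U Y -> smooth_section U Z ->
  anchor A x u (koszul2 w X Y Z) =
  anchor A x u (fun z => anchor A z (X z) (fun y => w y (pair2 (Y y) (Z y))))
  - anchor A x u (fun z => anchor A z (Y z) (fun y => w y (pair2 (X y) (Z y))))
  + anchor A x u (fun z => anchor A z (Z z) (fun y => w y (pair2 (X y) (Y y))))
  - anchor A x u (fun z => w z (pair2 (bracket A X Y z) (Z z)))
  + anchor A x u (fun z => w z (pair2 (bracket A X Z z) (Y z)))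
  - anchor A x u (fun z => w z (pair2 (bracket A Y Z z) (X z))).
Proof.
move=> XU YU ZU; rewrite /koszul2.
by rewrite !(anchorB oU Ux, anchorD oU Ux); prove_smooth.
Qed.

(** [psi] stands for - d_A w, known through its values on sections over [U]. Second derivatives
    cancel because the anchor preserves brackets, first derivatives such as rho(X)(w([Y, Z], T))
    occur twice with opposite signs, nested brackets cancel by the Jacobi identity, and terms
    pairing two brackets cancel because [w] is skew. *)
Lemma koszul3_koszul2 (psi : kform A 3) X Y Z T :
  (forall X Y Z y, U y -> smooth_section U X -> smooth_section U Y ->
     smooth_section U Z ->
     psi y (triple3 (X y) (Y y) (Z y)) = - koszul2 w X Y Z y) ->
  smooth_section U X -> smooth_section U Y -> smooth_section U Z ->
  smooth_section U T -> koszul3 psi X Y Z T x = 0.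
Proof.
move=> psiE XU YU ZU TU; have [w_alt _] := w_form; rewrite /koszul3.
have aE (u : A x) (X' Y' Z' : section A) : smooth_section U X' ->
    smooth_section U Y' -> smooth_section U Z' ->
    anchor A x u (fun y => psi y (triple3 (X' y) (Y' y) (Z' y))) =
    - anchor A x u (koszul2 w X' Y' Z').
  move=> XU' YU' ZU'; have K := koszul2_smooth w_form oU XU' YU' ZU'.
  rewrite -(anchorN oU Ux _ K); apply/esym/(anchor_ext oU Ux).
    exact: smooth_onN.
  by move=> y Uy; rewrite psiE.
have b (X' Y' : section A) : smooth_section U X' -> smooth_section U Y' ->
  smooth_section U (bracket A X' Y') by move=> *; exact: bracket_smooth.
rewrite !aE // !(psiE (bracket A _ _) _ _ x Ux) //; try exact: b.
rewrite !anchor_koszul2 // /koszul2.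
rewrite !(fun X' Y' f XU' YU' => @anchor_bracket _ _ A U X' Y' f oU XU' YU');
  try by prove_smooth.
have J (X' Y' Z' T' : section A) : smooth_section U X' -> smooth_section U Y' ->
    smooth_section U Z' -> w x (pair2 (bracket A (bracket A X' Y') Z' x) (T' x)) =
    w x (pair2 (bracket A (bracket A X' Z') Y' x) (T' x))
    - w x (pair2 (bracket A (bracket A Y' Z') X' x) (T' x)).
  move=> XU' YU' ZU'; rewrite bracket_jacobi_left //.
  by rewrite (alt2Dl (w_alt x)) (alt2Nl (w_alt x)).
(* One Jacobi identity for each choice of the section left out of the nested bracket. *)
rewrite (J X Y Z T) // (J X Y T Z) // (J X Z T Y) // (J Y Z T X) //.
(* Complementary brackets, such as [X, Y] and [Z, T], are paired by [w] in both orders; they are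
   brought to one order for [ring] to cancel them. *)
rewrite (alt2_skew (w_alt x) (bracket A Z T x)).
rewrite (alt2_skew (w_alt x) (bracket A Y T x)).
rewrite (alt2_skew (w_alt x) (bracket A Y Z x) (bracket A X T x)).
ring.
Qed.

End SquareZero.

(** The outer [dA] evaluates d_A w at points near [x] on sections with constant coordinates in the
    frame around [x], while the inner [dA] extends their values in the frames around those points;
    [dA2E] reconciles the two. *)
Lemma dA_dA2 (R : realType) (M : manifold R) (A : lie_algebroid M)
    (w : kform A 2) : is_kform w ->
  forall x (v : 'I_4 -> A x), dA (fun x v => - dA w x v) x v = 0.
Proof.
move=> w_form x v; rewrite {1}/dA koszul3E.
apply: (koszul3_koszul2 w_form (frame_dom_open A x) (frame_dom_mem A x));
  try exact: extend_smooth.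
by move=> X Y Z y Uy XU YU ZU; congr (- _);
  exact: (dA2E w_form (frame_dom_open A x) Uy XU YU ZU).
Qed.

(** * The Schouten square of a bivector *)

Section Wedge3.
Variables (R : realType) (V : vectType R).

(** Covectors take values in [R^o]; this and the next two restatements put the equations in [R],
    where [ring] works. *)
Lemma dualD (a : dual V) u v : a (u + v) = (a u : R) + a v :> R.
Proof. exact: linearD. Qed.

Lemma dualN (a : dual V) u : a (- u) = - (a u : R) :> R.
Proof. exact: linearN. Qed.

Lemma dualZ (a : dual V) k u : a (k *: u) = k * (a u : R) :> R.
Proof. exact: linearZ. Qed.

(** Laplace expansion along the column of [u] turns the determinant into a polynomial in the nine
    pairings, so that comparisons of trivectors become goals for [ring]. *)
Lemma wedge3E (u v w : V) (a : 'I_3 -> dual V) :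
  let a0 : V -> R := a ord0 in let a1 : V -> R := a (lift ord0 ord0) in
  let a2 : V -> R := a (lift ord0 (lift ord0 ord0)) in
  wedge (triple3 u v w) a =
    a0 u * (a1 v * a2 w - a1 w * a2 v) + a1 u * (a2 v * a0 w - a2 w * a0 v)
    + a2 u * (a0 v * a1 w - a0 w * a1 v).
Proof.
move=> a0 a1 a2; rewrite /wedge (expand_det_col _ ord0) !big_ord_recl big_ord0.
rewrite /cofactor !(expand_det_row _ ord0) !big_ord_recl !big_ord0.
rewrite /cofactor !det_mx11 !mxE /=.
pose i0 : 'I_3 := ord0; pose i1 : 'I_3 := lift ord0 ord0.
pose i2 : 'I_3 := lift ord0 (lift ord0 ord0).
have -> : lift ord0 (lift ord0 0) = i2 by apply: val_inj.
have -> : lift ord0 (lift (lift ord0 ord0) 0) = i1 by apply: val_inj.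
have -> : lift i1 ord0 = i0 by apply: val_inj.
have -> : lift i1 (lift ord0 0) = i2 by apply: val_inj.
have -> : lift i2 ord0 = i0 by apply: val_inj.
have -> : lift i2 (lift ord0 0) = i1 by apply: val_inj.
rewrite /triple3 !(tnth_nth (0 : V)) /bump /=.
rewrite -/(a0 u) -/(a0 v) -/(a0 w) -/(a1 u) -/(a1 v) -/(a1 w).
by rewrite -/(a2 u) -/(a2 v) -/(a2 w); ring.
Qed.

End Wedge3.

(** * The Schouten square of a sum of decomposable bivectors *)

Section SchoutenIdentity.
Variables (R : realType) (M : manifold R) (A : lie_algebroid M).
Variables (U : set M) (x : M) (oU : open U) (Ux : U x).
Implicit Types (I J : section A * section A) (a b c : cosection A).

(* A pair (X, Y) stands for the bivector X /\ Y. *)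
Definition pair_vector I y (a b : dual (A y)) : R :=
  a (I.1 y) * b (I.2 y) - a (I.2 y) * b (I.1 y).

(** The contraction a(X) Y - a(Y) X of X /\ Y with [a], the sign being moved into a coefficient so
    that the bracket rules for sums and multiples apply. *)
Definition pair_sharp I a : section A :=
  fun y => (a y (I.1 y) : R) *: I.2 y + (- a y (I.2 y) : R) *: I.1 y.

Definition smooth_pair I := smooth_section U I.1 /\ smooth_section U I.2.

Lemma pair_sharp_smooth I a : smooth_pair I -> smooth_cosection U a ->
  smooth_section U (pair_sharp I a).
Proof.
move=> [I1 I2] aU; apply: smooth_sectionD => //; apply: smooth_sectionZ => //.
  exact: smooth_pairing.
by apply: smooth_onN => //; exact: smooth_pairing.
Qed.

Lemma pair_vector_smooth I b c : smooth_pair I -> smooth_cosection U b ->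
  smooth_cosection U c -> smooth_on U (fun y => pair_vector I (b y) (c y)).
Proof.
move=> [I1 I2] bU cU.
by apply: smooth_onB => //; apply: smooth_onM => //; exact: smooth_pairing.
Qed.

Lemma bracketZZ f g (X Y : section A) : smooth_on U f -> smooth_on U g ->
  smooth_section U X -> smooth_section U Y ->
  bracket A (fun y => f y *: X y : A y) (fun y => g y *: Y y : A y) x =
    (f x * g x) *: bracket A X Y x + (f x * anchor A x (X x) g) *: Y x
    - (g x * anchor A x (Y x) f) *: X x.
Proof.
move=> fU gU XU YU; rewrite (bracketZr oU Ux) //; last exact: smooth_sectionZ.
rewrite (bracketZl oU Ux) // (anchorZl oU Ux) // scalerBr !scalerA.
by rewrite (mulrC (g x) (f x)) addrAC.
Qed.

(** A summand of the cyclic formula, polarized: the two occurrences of the bivector are given to two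
    decomposable bivectors. *)
Definition schouten_term I J a b c : R :=
  c x (bracket A (pair_sharp I a) (pair_sharp J b) x)
  - anchor A x (pair_sharp I a x) (fun y => pair_vector J (b y) (c y)).

(** The derivatives of [b] produced by the bracket cancel against those of the anchor term. The
    surviving derivatives of [a] will cancel against those of the third argument in the cyclically
    permuted term with [I] and [J] exchanged. *)
Lemma schouten_termE I J a b c : smooth_pair I -> smooth_pair J ->
  smooth_cosection U a -> smooth_cosection U b -> smooth_cosection U c ->
  let D u d X := anchor A x u (fun y => d y (X y)) in
  schouten_term I J a b c =
    a x (I.1 x) * b x (J.1 x) * c x (bracket A I.2 J.2 x)
    - a x (I.1 x) * b x (J.2 x) * c x (bracket A I.2 J.1 x)
    - a x (I.2 x) * b x (J.1 x) * c x (bracket A I.1 J.2 x)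
    + a x (I.2 x) * b x (J.2 x) * c x (bracket A I.1 J.1 x)
    - c x (I.2 x) * (b x (J.1 x) * D (J.2 x) a I.1 - b x (J.2 x) * D (J.1 x) a I.1)
    + c x (I.1 x) * (b x (J.1 x) * D (J.2 x) a I.2 - b x (J.2 x) * D (J.1 x) a I.2)
    - a x (I.1 x) * (b x (J.1 x) * D (I.2 x) c J.2 - b x (J.2 x) * D (I.2 x) c J.1)
    + a x (I.2 x) * (b x (J.1 x) * D (I.1 x) c J.2 - b x (J.2 x) * D (I.1 x) c J.1).
Proof.
move=> [I1 I2] [J1 J2] aU bU cU D.
have ev d X : smooth_cosection U d -> smooth_section U X ->
  smooth_on U (fun y => d y (X y) : R) by exact: smooth_pairing.
rewrite /schouten_term /pair_sharp /pair_vector.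
rewrite (bracketDl oU Ux) ?(bracketDr oU Ux); try by prove_smooth; exact: ev.
rewrite !bracketZZ; try by prove_smooth; exact: ev.
rewrite (anchorDl oU Ux) ?(anchorZl oU Ux) ?(anchorB oU Ux) ?(anchorN oU Ux)
  ?(anchorM oU Ux); try by prove_smooth; exact: ev.
rewrite !(dualD, dualN, dualZ) /D; ring.
Qed.

(* The polarization of 1/2 [P, P] (a, b, c) =
   sum over cyclic permutations of
     c ([P^sharp a, P^sharp b]) - rho (P^sharp a) (P (b, c)). *)
Lemma schouten_decomposableE I J a b c : smooth_pair I -> smooth_pair J ->
  smooth_cosection U a -> smooth_cosection U b -> smooth_cosection U c ->
  schouten_decomposable I J (triple3 (a x) (b x) (c x)) =
    (schouten_term I J a b c + schouten_term I J b c a + schouten_term I J c a b)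
    + (schouten_term J I a b c + schouten_term J I b c a + schouten_term J I c a b).
Proof.
move=> IU JU aU bU cU; rewrite !schouten_termE //.
rewrite /schouten_decomposable !wedge3E /triple3 !(tnth_nth (0 : dual (A x))) /=.
have [I1 I2] := IU; have [J1 J2] := JU.
rewrite (bracket_skew oU J1 I1 Ux) (bracket_skew oU J2 I2 Ux).
rewrite (bracket_skew oU J1 I2 Ux) (bracket_skew oU J2 I1 Ux) !dualN.
ring.
Qed.

Variables (K : Type) (s : seq K) (F : K -> section A * section A).
Hypothesis F_smooth : forall k, smooth_pair (F k).
Variable P : kvector A 2.
Arguments P : clear implicits.
Hypothesis P_alt : forall y, is_alternating (P y).
Hypothesis PE : forall y (a b : dual (A y)), U y ->
  P y (pair2 a b) = \sum_(k <- s) pair_vector (F k) a b.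

(** A single summand; the cyclic sum consists of its three cyclic permutations. *)
Definition schouten_cyclic a b c : R :=
  c x (bracket A (fun y => sharp (P y) (a y)) (fun y => sharp (P y) (b y)) x)
  - anchor A x (sharp (P x) (a x)) (fun y => P y (pair2 (b y) (c y))).

Lemma sharp_sum a y : U y ->
  sharp (P y) (a y) = \sum_(k <- s) pair_sharp (F k) a y.
Proof.
move=> Uy; apply: dual_ext => d; rewrite dual_sharp // PE // linear_sum.
apply: eq_bigr => k _; rewrite /pair_vector /pair_sharp [RHS]dualD !dualZ.
by rewrite mulNr.
Qed.

Lemma schouten_term_sum a b c : smooth_cosection U a -> smooth_cosection U b ->
  smooth_cosection U c ->
  \sum_(k <- s) \sum_(l <- s) schouten_term (F k) (F l) a b c
    = schouten_cyclic a b c.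
Proof.
move=> aU bU cU; rewrite /schouten_cyclic.
have sU d : smooth_cosection U d ->
    smooth_section U (fun y => \sum_(k <- s) pair_sharp (F k) d y : A y).
  by move=> dU; apply: smooth_section_sum => // k; exact: pair_sharp_smooth.
have -> : bracket A (fun y => sharp (P y) (a y)) (fun y => sharp (P y) (b y)) x =
    \sum_(k <- s) \sum_(l <- s)
      bracket A (pair_sharp (F k) a) (pair_sharp (F l) b) x.
  rewrite -(bracket_sum oU Ux); [|by move=> k; exact: pair_sharp_smooth..].
  (* The decomposition of [P] holds on [U] only, hence the appeal to locality of the bracket. *)
  by apply/esym/(bracket_local oU) => // [||y Uy|y Uy];
    [exact: sU|exact: sU|rewrite sharp_sum..].
have -> : anchor A x (sharp (P x) (a x)) (fun y => P y (pair2 (b y) (c y))) =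
    \sum_(k <- s) \sum_(l <- s) anchor A x (pair_sharp (F k) a x)
      (fun y => pair_vector (F l) (b y) (c y)).
  have vU l := pair_vector_smooth (F_smooth l) bU cU.
  rewrite sharp_sum // -(@anchor_ext _ _ _ _ _ oU Ux _
    (fun y => \sum_(l <- s) pair_vector (F l) (b y) (c y))) //; first last.
  - by move=> y Uy; rewrite PE.
  - exact: smooth_on_sum.
  rewrite (anchor_suml oU Ux) //; last exact: smooth_on_sum.
  by apply: eq_bigr => k _; rewrite (anchor_sum oU Ux).
rewrite linear_sum -sumrB; apply: eq_bigr => k _.
by rewrite linear_sum -sumrB.
Qed.

Lemma schouten_decomposable_sum a b c : smooth_cosection U a ->
  smooth_cosection U b -> smooth_cosection U c ->
  \sum_(k <- s) \sum_(l <- s)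
     schouten_decomposable (F k) (F l) (triple3 (a x) (b x) (c x))
    = 2 * (schouten_cyclic a b c + schouten_cyclic b c a + schouten_cyclic c a b).
Proof.
move=> aU bU cU.
pose S k l := schouten_term (F k) (F l) a b c + schouten_term (F k) (F l) b c a
  + schouten_term (F k) (F l) c a b.
have <- : \sum_(k <- s) \sum_(l <- s) S k l =
    schouten_cyclic a b c + schouten_cyclic b c a + schouten_cyclic c a b.
  rewrite -!schouten_term_sum // -!big_split; apply: eq_bigr => k _.
  by rewrite -!big_split.
(* The two halves of the polarized identity differ by the exchange of [k] and [l], so they have the
   same double sum; this is the factor 2. *)
rewrite mulrDl mul1r [X in _ = _ + X]exchange_big -big_split.
apply: eq_bigr => k _; rewrite -big_split; apply: eq_bigr => l _.
exact: schouten_decomposableE.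
Qed.

End SchoutenIdentity.

(** * The Schouten square of an arbitrary bivector *)

Section SchoutenSquare.
Variables (R : realType) (M : manifold R) (A : lie_algebroid M).
Variable P : kvector A 2.
Arguments P : clear implicits.
Hypothesis P_kvector : is_kvector P.

Lemma bivector_frame (p y : M) (a b : dual (A y)) : frame_dom A p y ->
  P y (pair2 a b) = \sum_i \sum_j
    P y (pair2 (linfun (coord (frame A p y) i)) (linfun (coord (frame A p y) j)))
    * ((a (tnth (frame A p y) i) : R) * b (tnth (frame A p y) j)).
Proof.
move=> py; have [P_alt _] := P_kvector; have bas := frame_basis py.
rewrite {1}(dual_coord_sum a bas) alt2_suml //; apply: eq_bigr => i _.
rewrite {1}(dual_coord_sum b bas) alt2_sumr // mulr_sumr; apply: eq_bigr => j _.
ring.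
Qed.

Lemma schouten_square (x : M) (a : 'I_3 -> dual (A x)) :
  let a0 := coextend (a ord0) in let a1 := coextend (a (lift ord0 ord0)) in
  let a2 := coextend (a (lift ord0 (lift ord0 ord0))) in
  2^-1 * schouten P P x a = schouten_cyclic x P a0 a1 a2
    + schouten_cyclic x P a1 a2 a0 + schouten_cyclic x P a2 a0 a1.
Proof.
move=> a0 a1 a2; have [P_alt _] := P_kvector.
have oU := frame_dom_open A x; have Ux := frame_dom_mem A x.
pose e (i : 'I_(rk A)) y := linfun (coord (frame A x y) i) : dual (A y).
(* [F] gives the pairs of [decompose P x], indexed by couples of frame indices, as a family to which
   the previous section applies. *)
pose F (k : 'I_(rk A) * 'I_(rk A)) : section A * section A :=
  (fun y => (2^-1 * P y (pair2 (e k.1 y) (e k.2 y))) *: tnth (frame A x y) k.1,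
   fun y => tnth (frame A x y) k.2).
pose s := [seq (i, j) | i <- enum 'I_(rk A), j <- enum 'I_(rk A)].
have Fs k : smooth_pair (frame_dom A x) (F k).
  split; last exact: smooth_frame.
  apply: smooth_sectionZ => //; last exact: smooth_frame.
  apply: smooth_onM => //; first exact: smooth_on_cst.
  by apply: smooth_vector2 => //; exact: smooth_coord.
have PE y (b c : dual (A y)) : frame_dom A x y ->
    P y (pair2 b c) = \sum_(k <- s) pair_vector (F k) b c.
  move=> xy; rewrite big_allpairs /= !big_enum /=.
  pose p i j := P y (pair2 (e i y) (e j y)).
  pose t i j := p i j * ((b (tnth (frame A x y) i) : R) * c (tnth (frame A x y) j)).
  (* Skewness of [P] turns the antisymmetrization in [i] and [j] into a symmetrization of [t];
     summed over all couples, the two halves add up to the frame expansion of [P]. *)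
  have pE i j : pair_vector (F (i, j)) b c = 2^-1 * t i j + 2^-1 * t j i.
    rewrite /pair_vector /= !dualZ -/(p i j) /t.
    by rewrite /p (alt2_skew (P_alt y) (e j y)); ring.
  under eq_bigr => i _.
    rewrite big_enum /=; under eq_bigr do rewrite pE.
    rewrite big_split /=; over.
  rewrite big_split /= [X in _ = _ + X]exchange_big /=.
  rewrite (bivector_frame b c xy) -[RHS]mulr2n.
  under [X in _ = X *+ 2]eq_bigr do rewrite -mulr_sumr.
  by rewrite -mulr_sumr; lra.
have -> : schouten P P x a = \sum_(k <- s) \sum_(l <- s)
    schouten_decomposable (F k) (F l) (triple3 (a0 x) (a1 x) (a2 x)).
  have -> : triple3 (a0 x) (a1 x) (a2 x) = a.
    by rewrite /a0 /a1 /a2 !coextend_at -triple3_eta.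
  have dE : decompose P x = map F s by rewrite map_allpairs.
  rewrite /schouten dE big_map.
  by under eq_bigr do rewrite big_map.
rewrite (schouten_decomposable_sum oU Ux Fs P_alt PE); [|exact: coextend_smooth..].
lra.
Qed.

End SchoutenSquare.

(** * The inverse of the restriction to a subalgebroid *)

Section PushedBivector.
Variables (R : realType) (M : manifold R) (A B : lie_algebroid M).
Variable h : bundle_map B A.
Arguments h : clear implicits.
Hypothesis h_sub : lie_subalgebroid h.
Implicit Types (U : set M) (P : kvector B 2).

Lemma subalgebroid_section U (Z : section B) : open U -> smooth_section U Z ->
  smooth_section U (fun x => h x (Z x) : A x).
Proof. by have [_ + _ _] := h_sub; apply. Qed.

Lemma smooth_cosection_comp U (a : cosection A) : smooth_cosection U a ->
  smooth_cosection U (fun x => (a x \o h x)%VF : dual (B x)).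
Proof.
move=> aU V Z oV VU ZV; under eq_fun do rewrite comp_lfunE.
by apply: (aU V (fun x => h x (Z x))) => //; exact: subalgebroid_section.
Qed.

Lemma is_kvector_push P : is_kvector P -> is_kvector (push_kvector h P).
Proof.
move=> [P_alt P_smooth]; split=> [x|U a oU aU]; first exact: push_alternating.
apply: (P_smooth U (fun i x => (a i x \o h x)%VF : dual (B x))) => // i.
exact: smooth_cosection_comp.
Qed.

Lemma push_pair2 P x (a b : dual (A x)) :
  push_kvector h P x (pair2 a b) = P x (pair2 ((a \o h x)%VF : dual (B x)) (b \o h x)%VF).
Proof.
rewrite /push_kvector; congr (P x _).
exact: (pair2_comp (fun c : dual (A x) => (c \o h x)%VF : dual (B x))).
Qed.

(** For the pushed bivector Q this is Q^sharp = h P^sharp h^t, with h^t the transpose of [h],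
    checked against covectors. In particular Q^sharp takes its values in the image of [h]. *)
Lemma sharp_push P x (a : dual (A x)) : is_alternating (P x) ->
  sharp (push_kvector h P x) a = h x (sharp (P x) (a \o h x)%VF).
Proof.
move=> P_alt; apply: dual_ext => d.
have Q_alt : is_alternating (push_kvector h P x) by exact: push_alternating.
rewrite (dual_sharp Q_alt) push_pair2.
by rewrite -comp_lfunE dual_sharp.
Qed.

(** The image of Q^sharp is that of [h]: P^sharp is onto, and so is the transpose of the injective
    map [h]. The constant rank is the rank of [B]. *)
Lemma regular_push P : is_kvector P -> (forall x, bijective (sharp_hom (P x))) ->
  regular (push_kvector h P).
Proof.
move=> P_kvector P_bij; have [P_alt _] := P_kvector; have [h_inj _ _ _] := h_sub.
exists (rk B) => x; have hk : lker (h x) == 0%VS by apply/lker0P; exact: h_inj.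
have -> : limg (sharp_hom (push_kvector h P x)) = limg (h x).
  have Q_alt : is_alternating (push_kvector h P x) by exact: push_alternating.
  apply/vspaceP => u; apply/memv_imgP/memv_imgP => -[v _ ->].
    by exists (sharp (P x) (v \o h x)%VF); rewrite ?memvf // sharp_homE // sharp_push.
  have [g _ gK] := P_bij x.
  (* The covector [g v] on [B] is extended to [A] by composition with a left inverse of [h]; pulling
     back along [h] recovers it. *)
  exists (g v \o (h x)^-1)%VF; rewrite ?memvf // sharp_homE // sharp_push //.
  by rewrite -comp_lfunA lker0_compVf // comp_lfun1r -sharp_homE // gK.
rewrite limg_dim_eq ?(eqP hk) ?capv0 //.
exact: (size_basis (frame_basis (frame_dom_mem B x))).
Qed.

(** * The twisted Poisson identity for the inverse of the restricted form *)

Section InverseForm.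
Variable omega : kform A 2.
Arguments omega : clear implicits.
Variable P : kvector B 2.
Arguments P : clear implicits.
Hypothesis omega_form : is_kform omega.
Hypothesis P_kvector : is_kvector P.
Hypothesis P_inv : forall x, inverse_of (P x) (restrict_form h omega x).

Let Q : kvector A 2 := push_kvector h P.
Arguments Q : clear implicits.

(** With d the restriction of [a] to [B], Q^sharp a is the image under [h] of P^sharp d, and
    i_(P^sharp d) of the restricted form is - (P^sharp)^-1 (P^sharp d) = - d; skewness removes the
    sign. The inverse is taken on [B], which is why the other vector comes from [B]. *)
Lemma inverse_form_sharp x (a : dual (A x)) (u : B x) :
  omega x (pair2 (h x u) (sharp (Q x) a)) = a (h x u).
Proof.
have [P_alt _] := P_kvector; have [w_alt _] := omega_form.
rewrite (alt2_skew (w_alt x)) /Q sharp_push //.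
set d : dual (B x) := (a \o h x)%VF.
have [P_bij /(_ (sharp (P x) d) u)] := P_inv x.
rewrite /restrict_form (pair2_comp (h x)) => ->; rewrite opprK.
rewrite -sharp_homE // lker0_lfunK ?comp_lfunE //.
by apply/lker0P; exact: bij_inj.
Qed.

(** Q^sharp a comes from [B], so the previous lemma gives b(Q^sharp a), which is Q(a, b). *)
Lemma inverse_form_sharp2 x (a b : dual (A x)) :
  omega x (pair2 (sharp (Q x) a) (sharp (Q x) b)) = Q x (pair2 a b).
Proof.
have [P_alt _] := P_kvector.
have Q_alt : is_alternating (push_kvector h P x) by exact: push_alternating.
by rewrite {1}/Q sharp_push // inverse_form_sharp -sharp_push // dual_sharp.
Qed.

(* B being a subalgebroid, [Q^sharp a, Q^sharp b] is a section of B, and so its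
   contraction with i_(Q^sharp c) omega is - c ([Q^sharp a, Q^sharp b]). *)
Lemma schouten_inverse_form x (a : 'I_3 -> dual (A x)) :
  2^-1 * schouten Q Q x a = wedge_sharp Q (fun x v => - dA omega x v) x a.
Proof.
have [P_alt _] := P_kvector; have Q_kvector := is_kvector_push P_kvector.
have [Q_alt _] := Q_kvector; have [w_alt _] := omega_form.
rewrite (schouten_square Q_kvector) /wedge_sharp.
set a0 := coextend (a ord0); set a1 := coextend (a (lift ord0 ord0)).
set a2 := coextend (a (lift ord0 (lift ord0 ord0))).
have oU := frame_dom_open A x; have Ux := frame_dom_mem A x.
pose X (c : cosection A) : section A := fun y => sharp (Q y) (c y).
have XU c : smooth_cosection (frame_dom A x) c ->
    smooth_section (frame_dom A x) (X c) by exact: smooth_sharp.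
have a0U : smooth_cosection (frame_dom A x) a0 by exact: coextend_smooth.
have a1U : smooth_cosection (frame_dom A x) a1 by exact: coextend_smooth.
have a2U : smooth_cosection (frame_dom A x) a2 by exact: coextend_smooth.
(* The form d_A omega is computed on the sections Q^sharp of [a0], [a1] and [a2], for which the
   values of omega are known near [x]. *)
rewrite (dA2E omega_form oU Ux (XU _ a0U) (XU _ a1U) (XU _ a2U));
  [|by rewrite /X /a0 /a1 /a2 coextend_at..].
have wX c d : (fun y => omega y (pair2 (X c y) (X d y))) =
    fun y => Q y (pair2 (c y) (d y)).
  by apply/funext => y; exact: inverse_form_sharp2.
have wb b c d : smooth_cosection (frame_dom A x) b ->
    smooth_cosection (frame_dom A x) c ->
    omega x (pair2 (bracket A (X b) (X c) x) (X d x)) =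
    d x (bracket A (X b) (X c) x).
  move=> bU cU; pose Z (e : cosection A) : section B :=
    fun y => sharp (P y) (e y \o h y)%VF.
  have XZ e : X e = fun y => h y (Z e y).
    by apply: functional_extensionality_dep => y; exact: sharp_push.
  have ZU e : smooth_cosection (frame_dom A x) e ->
      smooth_section (frame_dom A x) (Z e).
    by move=> eU; apply: smooth_sharp => //; exact: smooth_cosection_comp.
  have [_ _ _ h_bracket] := h_sub.
  rewrite (XZ b) (XZ c) (h_bracket _ _ _ oU (ZU _ bU) (ZU _ cU) _ Ux).
  exact: inverse_form_sharp.
have Qs b c : (fun y => Q y (pair2 (b y) (c y))) = fun y => - Q y (pair2 (c y) (b y)).
  by apply/funext => y; exact: alt2_skew.
have QU := smooth_vector2 Q_kvector oU.
rewrite /koszul2 !wX !wb // /schouten_cyclic -/(X a0) -/(X a1) -/(X a2).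
(* The cyclic sum has [a2] before [a0] in one value of [Q] and in one bracket, the Koszul formula
   has [a0] before [a2]; both signs are adjusted. *)
rewrite (Qs a2 a0) (anchorN oU Ux); last exact: QU.
rewrite (bracket_skew oU (XU _ a2U) (XU _ a0U) Ux) dualN.
rewrite -/(X a0 x) -/(X a1 x) -/(X a2 x).
ring.
Qed.

End InverseForm.
End PushedBivector.

Theorem corollary3p2 (R : realType) (M : manifold R) (A B : lie_algebroid M)
    (h : bundle_map B A) (omega : kform A 2) (P : kvector B 2) :
  lie_subalgebroid h ->
  is_kform omega ->
  (forall x, nondegenerate_form (restrict_form h omega x)) ->
  is_kvector P ->
  (forall x, inverse_of (P x) (restrict_form h omega x)) ->
  twisted_poisson (push_kvector h P) (fun x v => - dA omega x v) /\
  regular (push_kvector h P).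
Proof.
move=> h_sub w_form _ P_kvector P_inv.
split; last by apply: regular_push => // x; case: (P_inv x).
split; [exact: is_kvector_push|exact: is_kformN (is_kform_dA w_form)|exact: dA_dA2|].
exact: schouten_inverse_form.
Qed.
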